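(* Let $x:M^{n}\rightarrow M_1^{n+1}(c)$, $c\in\{0,1,-1\}$, be a spacelike hypersurface without umbilical points. Then the principal vectors (eigenvectors of the shape operator) and the conformal principal curvatures $b_1,\dots,b_n$ of $x$ are invariant under the conformal transformations of $M_1^{n+1}(c)$ (i.e. they are the same for $x$ and for $\phi\circ x$, for suitable choice of the unit normals, for every conformal transformation $\phi$). In particular, the Möbius curvatures $\mathbb{M}_{ijs}$ (defined when the number of distinct principal curvatures is at least $3$) are invariant under the conformal transformations of $M_1^{n+1}(c)$.
   Context: $\mathbb{R}^{m}_s$ denotes $\mathbb{R}^m$ with $\langle X,Y\rangle_s=-\sum_{i=1}^s x_iy_i+\sum_{j=s+1}^{m}x_jy_j$. The Lorentzian space form $M^{n+1}_1(c)$ is $\mathbb{R}^{n+1}_1$ for $c=0$, $\mathbb{S}^{n+1}_1(1)=\{x\in\mathbb{R}^{n+2}_1:\langle x,x\rangle_1=1\}$ for $c=1$, and $\mathbb{H}^{n+1}_1(-1)=\{x\in\mathbb{R}^{n+2}_2:\langle x,x\rangle_2=-1\}$ for $c=-1$. A spacelike hypersurface is a smooth immersion $x:M^n\to M^{n+1}_1(c)$ whose induced metric $I$ is positive definite. Let $e_{n+1}$ be a unit normal, $\langle e_{n+1},e_{n+1}\rangle=-1$, $II=\sum h_{ij}\theta_i\otimes\theta_j$ the second fundamental form in an $I$-orthonormal coframe, $\lambda_1,\dots,\lambda_n$ the principal curvatures (eigenvalues of $(h_{ij})$), $H=\frac1n\sum_i h_{ii}$, $|II|^2=\sum h_{ij}^2$,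 and $e^{2\tau}=\frac{n}{n-1}(|II|^2-nH^2)$, which is positive at non-umbilical points. The conformal principal curvatures are $b_i=e^{-\tau}(\lambda_i-H)$. The Möbius curvatures are $\mathbb{M}_{ijs}=\frac{\lambda_i-\lambda_j}{\lambda_i-\lambda_s}$ (for $\lambda_i\neq\lambda_s$). Replacing $e_{n+1}$ by $-e_{n+1}$ changes the sign of all $b_i$ simultaneously. Conformal transformations: let $\mathbb{Q}^{n+1}_1=\{[X]\in\mathbb{R}P^{n+2}:\langle X,X\rangle_2=0\}$, on which the group $O(n+3,2)$ of linear maps of $\mathbb{R}^{n+3}_2$ preserving $\langle,\rangle_2$ acts by $T([X])=[XT]$. Conformal embeddings $\sigma_c:M^{n+1}_1(c)\to\mathbb{Q}^{n+1}_1$ are $\sigma_0(u)=[(\frac{\langle u,u\rangle_1+1}{2},u,\frac{\langle u,u\rangle_1-1}{2})]$, $\sigma_1(u)=[(1,u)]$, $\sigma_{-1}(u)=[(u,1)]$. A conformal transformation $\phi$ of $M^{n+1}_1(c)$ is a map $\phi=\sigma_c^{-1}\circ T\circ\sigma_c$ with $T\in O(n+3,2)$ (possibly defined only on an open dense subset, in which case $x(M^n)$ is assumed to lie in its domain). *)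

(* Defs.v *)
From HB Require Import structures.
From mathcomp Require Import all_boot all_order all_algebra.
From mathcomp Require Import all_classical all_reals all_analysis.

Set Implicit Arguments.
Unset Strict Implicit.
Unset Printing Implicit Defensive.

Import Order.TTheory GRing.Theory Num.Theory.
Import numFieldNormedType.Exports.

Local Open Scope classical_set_scope.
Local Open Scope ring_scope.

Definition iter_derive (R : realType) (k m : nat)
    (f : 'rV[R]_k -> 'rV[R]_m) (vs : seq 'rV[R]_k) : 'rV[R]_k -> 'rV[R]_m :=
  foldr (fun v g => 'D_v g) f vs.

(* C^oo on an open set U: all iterated directional derivatives exist and are
   differentiable (hence continuous) at every point of U. *)
Definition smooth_on (R : realType) (k m : nat) (U : set 'rV[R]_k)
    (f : 'rV[R]_k -> 'rV[R]_m) : Prop :=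
  forall (vs : seq 'rV[R]_k) (q : 'rV[R]_k),
    U q -> differentiable (iter_derive f vs) q.

(* [chart_map] and [chart_inv] are total functions, meaningful only on
   [chart_dom] and on [chart_img] respectively. *)
Record chart (R : realType) (n : nat) (M : Type) := Chart {
  chart_dom : set M ;
  chart_map : M -> 'rV[R]_n ;
  chart_inv : 'rV[R]_n -> M }.

Definition chart_img (R : realType) (n : nat) (M : Type) (a : chart R n M) :
  set 'rV[R]_n := chart_map a @` chart_dom a.

Definition is_chart (R : realType) (n : nat) (M : topologicalType)
    (a : chart R n M) : Prop :=
  [/\ open (chart_dom a),
      open (chart_img a),
      (forall p, chart_dom a p -> chart_inv a (chart_map a p) = p),
      {within chart_dom a, continuous (chart_map a)} &
      {within chart_img a, continuous (chart_inv a)}].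

Definition smooth_atlas (R : realType) (n : nat) (M : topologicalType)
    (A : set (chart R n M)) : Prop :=
  [/\ (forall a, A a -> is_chart a),
      (forall p, exists2 a, A a & chart_dom a p) &
      (forall a b, A a -> A b ->
         smooth_on (chart_map a @` (chart_dom a `&` chart_dom b))
                   (chart_map b \o chart_inv a))].

Record smooth_manifold (R : realType) (n : nat) := SmoothManifold {
  mfd_carrier :> topologicalType ;
  atlas : set (chart R n mfd_carrier) ;
  mfd_hausdorff : hausdorff_space mfd_carrier ;
  mfd_second_countable : @second_countable mfd_carrier ;
  mfd_atlas : smooth_atlas atlas }.

Definition smooth_map (R : realType) (n m : nat) (M : smooth_manifold R n)
    (f : M -> 'rV[R]_m) : Prop :=
  forall a, atlas a -> smooth_on (chart_img a) (f \o chart_inv a).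

Definition partial1 (R : realType) (n m : nat) (M : Type) (a : chart R n M)
    (f : M -> 'rV[R]_m) (p : M) (i : 'I_n) : 'rV[R]_m :=
  'D_(delta_mx 0 i) (f \o chart_inv a) (chart_map a p).

Definition partial2 (R : realType) (n m : nat) (M : Type) (a : chart R n M)
    (f : M -> 'rV[R]_m) (p : M) (i j : 'I_n) : 'rV[R]_m :=
  'D_(delta_mx 0 i) ('D_(delta_mx 0 j) (f \o chart_inv a)) (chart_map a p).

Definition sform (R : realType) (s m : nat) (X Y : 'rV[R]_m) : R :=
  \sum_(i < m) (-1) ^+ (i < s)%N * (X 0 i * Y 0 i).

(* The three values c = 0, c = 1 and c = -1. *)
Variant curvature := Flat | DeSitter | AntiDeSitter.

Definition amb_dim (c : curvature) (n : nat) : nat :=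
  match c with Flat => n.+1 | DeSitter | AntiDeSitter => n.+2 end.

Definition amb_index (c : curvature) : nat :=
  match c with Flat | DeSitter => 1 | AntiDeSitter => 2 end.

Definition amb_form (R : realType) (n : nat) (c : curvature)
  (X Y : 'rV[R]_(amb_dim c n)) : R := sform (amb_index c) X Y.

Definition space_form (R : realType) (n : nat) (c : curvature) :
    set 'rV[R]_(amb_dim c n) :=
  match c with
  | Flat => setT
  | DeSitter => [set u | amb_form u u = 1]
  | AntiDeSitter => [set u | amb_form u u = -1]
  end.
Arguments space_form {R n} c.

Definition tangent_space_form (R : realType) (n : nat) (c : curvature)
    (u w : 'rV[R]_(amb_dim c n)) : Prop :=
  match c with
  | Flat => True
  | DeSitter | AntiDeSitter => amb_form u w = 0
  end.

(* The rows (t, u) and (u, t). *)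
Definition cons_rv (R : realType) (m : nat) (t : R) (u : 'rV[R]_m) :
  'rV[R]_m.+1 := \row_i oapp (u 0) t (unlift ord0 i).

Definition rcons_rv (R : realType) (m : nat) (u : 'rV[R]_m) (t : R) :
  'rV[R]_m.+1 := \row_i oapp (u 0) t (unlift ord_max i).

(* The point [X] of the projective space, represented by the line spanned by
   the nonzero vector X. *)
Definition proj_point (R : realType) (m : nat) (X : 'rV[R]_m) :
  set 'rV[R]_m := [set k *: X | k in [set: R]].

Definition proj_act (R : realType) (m : nat) (T : 'M[R]_m)
    (L : set 'rV[R]_m) : set 'rV[R]_m := [set X *m T | X in L].

Definition orthogonal_group (R : realType) (s m : nat) : set 'M[R]_m :=
  [set T | forall X Y : 'rV[R]_m, sform s (X *m T) (Y *m T) = sform s X Y].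

(* Its values are the points of the quadric of null lines; they are kept in
   the type of all subsets of the ambient space of that quadric. *)
Definition sigma (R : realType) (n : nat) (c : curvature) :
    'rV[R]_(amb_dim c n) -> set 'rV[R]_n.+3 :=
  match c with
  | Flat => fun u =>
      proj_point (cons_rv ((sform 1 u u + 1) / 2)
                          (rcons_rv u ((sform 1 u u - 1) / 2)))
  | DeSitter => fun u => proj_point (cons_rv 1 u)
  | AntiDeSitter => fun u => proj_point (rcons_rv u 1)
  end.
Arguments sigma {R n} c.

(* The largest set on which sigma^-1 \o T \o sigma is defined; it is open and
   dense in the space form. *)
Definition conformal_dom (R : realType) (n : nat) (c : curvature)
    (T : 'M[R]_n.+3) : set 'rV[R]_(amb_dim c n) :=
  [set u | space_form c u /\
     (sigma c @` space_form c) (proj_act T (sigma c u))].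

Definition conformal_map (R : realType) (n : nat) (c : curvature)
    (T : 'M[R]_n.+3) : 'rV[R]_(amb_dim c n) -> 'rV[R]_(amb_dim c n) :=
  'pinv_(fun=> 0) (space_form c) (sigma c) \o proj_act T \o sigma c.

(* From here on a tangent vector at p is given by its components v : 'rV_n in
   a chart a around p, and bilinear forms and endomorphisms of the tangent
   space by their matrices in the coordinate basis; endomorphisms act on row
   vectors from the right. *)

Definition first_form (R : realType) (n : nat) (c : curvature) (M : Type)
    (x : M -> 'rV[R]_(amb_dim c n)) (a : chart R n M) (p : M) : 'M[R]_n :=
  \matrix_(i, j) amb_form (partial1 a x p i) (partial1 a x p j).

Definition spacelike_hypersurface (R : realType) (n : nat) (c : curvature)
    (M : smooth_manifold R n) (x : M -> 'rV[R]_(amb_dim c n)) : Prop :=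
  [/\ (forall p, space_form c (x p)),
      smooth_map x,
      (forall (a : chart R n M) p, atlas a -> chart_dom a p ->
         row_free (\matrix_i partial1 a x p i)) &
      (forall (a : chart R n M) p, atlas a -> chart_dom a p ->
         forall v : 'rV[R]_n, v != 0 ->
           0 < (v *m first_form x a p *m v^T) 0 0)].

(* e is one of the two unit normal vectors of x at p (in the chart a). *)
Definition unit_normal_at (R : realType) (n : nat) (c : curvature) (M : Type)
    (x : M -> 'rV[R]_(amb_dim c n)) (a : chart R n M) (p : M)
    (e : 'rV[R]_(amb_dim c n)) : Prop :=
  [/\ tangent_space_form (x p) e,
      (forall i, amb_form (partial1 a x p i) e = 0) &
      amb_form e e = -1].

Definition unit_normal_field (R : realType) (n : nat) (c : curvature)
    (M : smooth_manifold R n) (x e : M -> 'rV[R]_(amb_dim c n)) : Prop :=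
  smooth_map e /\
  forall (a : chart R n M) p, atlas a -> chart_dom a p ->
    unit_normal_at x a p (e p).

(* The component along e of the second derivatives of x; the sign comes from
   <e, e> = -1. *)
Definition second_form (R : realType) (n : nat) (c : curvature) (M : Type)
    (x : M -> 'rV[R]_(amb_dim c n)) (a : chart R n M) (p : M)
    (e : 'rV[R]_(amb_dim c n)) : 'M[R]_n :=
  \matrix_(i, j) - amb_form (partial2 a x p i j) e.

(* The endomorphism S such that I(S v, w) = II(v, w). *)
Definition shape_operator (R : realType) (n : nat) (c : curvature) (M : Type)
    (x : M -> 'rV[R]_(amb_dim c n)) (a : chart R n M) (p : M)
    (e : 'rV[R]_(amb_dim c n)) : 'M[R]_n :=
  second_form x a p e *m invmx (first_form x a p).

Definition principal_vector (R : realType) (n : nat) (c : curvature)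
    (M : Type) (x : M -> 'rV[R]_(amb_dim c n)) (a : chart R n M) (p : M)
    (e : 'rV[R]_(amb_dim c n)) (l : R) (v : 'rV[R]_n) : Prop :=
  v != 0 /\ v *m shape_operator x a p e = l *: v.

Definition umbilical_at (R : realType) (n : nat) (c : curvature) (M : Type)
    (x : M -> 'rV[R]_(amb_dim c n)) (a : chart R n M) (p : M) : Prop :=
  exists e : 'rV[R]_(amb_dim c n), unit_normal_at x a p e /\
    exists l : R, second_form x a p e = l *: first_form x a p.

Definition no_umbilical_point (R : realType) (n : nat) (c : curvature)
    (M : smooth_manifold R n) (x : M -> 'rV[R]_(amb_dim c n)) : Prop :=
  forall (a : chart R n M) p, atlas a -> chart_dom a p ->
    ~ umbilical_at x a p.

(* The rows of E are an I-orthonormal basis of the tangent space at p. *)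
Definition orthonormal_frame (R : realType) (n : nat) (c : curvature)
    (M : Type) (x : M -> 'rV[R]_(amb_dim c n)) (a : chart R n M) (p : M)
    (E : 'M[R]_n) : Prop :=
  E *m first_form x a p *m E^T = 1%:M.

(* The matrix (h_ij) of II in the frame E. *)
Definition hcoef (R : realType) (n : nat) (c : curvature) (M : Type)
    (x : M -> 'rV[R]_(amb_dim c n)) (a : chart R n M) (p : M)
    (e : 'rV[R]_(amb_dim c n)) (E : 'M[R]_n) : 'M[R]_n :=
  E *m second_form x a p e *m E^T.

Definition principal_curvatures (R : realType) (n : nat) (h : 'M[R]_n)
    (l : 'I_n -> R) : Prop :=
  char_poly h = \prod_(i < n) ('X - (l i)%:P).

Definition mean_curvature (R : realType) (n : nat) (h : 'M[R]_n) : R :=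
  n%:R^-1 * \sum_(i < n) h i i.

Definition norm2_II (R : realType) (n : nat) (h : 'M[R]_n) : R :=
  \sum_(i < n) \sum_(j < n) h i j ^+ 2.

Definition tau (R : realType) (n : nat) (h : 'M[R]_n) : R :=
  ln (n%:R / (n%:R - 1) * (norm2_II h - n%:R * mean_curvature h ^+ 2)) / 2.

(* The conformal principal curvature attached to the principal curvature l. *)
Definition conformal_curvature (R : realType) (n : nat) (h : 'M[R]_n)
    (l : R) : R := expR (- tau h) * (l - mean_curvature h).

Definition conformal_curvatures (R : realType) (n : nat) (h : 'M[R]_n)
    (b : 'I_n -> R) : Prop :=
  exists l : 'I_n -> R, principal_curvatures h l /\
    forall i, b i = conformal_curvature h (l i).

(* M_ijs, for the principal curvatures li, lj, ls with li != ls. *)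
Definition moebius_curvature (R : realType) (li lj ls : R) : R :=
  (li - lj) / (li - ls).

(* Main.v *)
Require Import Defs.
From HB Require Import structures.
From mathcomp Require Import all_boot all_order all_algebra.
From mathcomp Require Import all_classical all_reals all_analysis.
From mathcomp Require Import ring.

Set Implicit Arguments.
Unset Strict Implicit.
Unset Printing Implicit Defensive.

Import Order.TTheory GRing.Theory Num.Theory.
Import numFieldNormedType.Exports.

Local Open Scope classical_set_scope.
Local Open Scope ring_scope.

(* Let F, G be the lifts of x and of y = phi o x to the light cone, normalised by
   a fixed linear form. Then F T = k G for a nonvanishing function k, and since
   F and G are null, I_x = k^2 I_y. A unit normal of x lifts to a vector N
   orthogonal to F and to its first derivatives; N T, corrected by a multiple of
   G, is the lift of a unit normal of y. Pairing the second derivatives of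
   F T = k G with N T gives II_y = |k|^-1 II_x + alpha I_y, so the shape operators
   are related by S_y = |k| S_x + alpha. Hence they have the same eigenvectors,
   tau increases by ln |k|, and the b_i and the quotients of differences of
   eigenvalues do not change. *)

(** * Smooth functions on an open set *)

(** The linear form equals 1 on every lift, so all derivatives of a lift lie in its kernel; on that
    kernel the projection back to the ambient space is an isometry. Hence every form of x and y
    becomes a pairing in the space of the light cone. The term alpha I_y originates in <DG, G> = 0,
    whose derivative gives <DDG, G> = - <DG, DG>: the multiple of G that corrects N T is seen by the
    second derivatives as a multiple of the metric. The factor k may be negative, so the transported
    normal is multiplied by the sign of k, which is locally constant and thus keeps the normal field
    smooth. The map phi is given only through a pseudo-inverse of [sigma]; smoothness of y is
    recovered from an explicit quotient, and y has no umbilical point because the same argument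
    applies to the inverse of T. *)

(** Differentiability depends only on the germ: the first-order expansion of [f] at [a] is also one
    of [g], and uniqueness of the differential identifies its linear part. *)
Lemma near_eq_differentiable (R : numFieldType) (V W : normedModType R)
    (f g : V -> W) (a : V) :
  (\near a, f a = g a) -> differentiable f a -> differentiable g a.
Proof.
move=> fg /diff_locallyP[dfc dfl].
have E : g \o shift a = cst (g a) + ('d f a : V -> W) +o_ (0 : V) id.
  apply/eqaddoP => _ /posnumP[e]; move/eqaddoP: dfl => /(_ e%:num).
  move=> /(_ (gt0 _)) H.
  have fg0 : \forall h \near (0 : V), f (h + a) = g (h + a).
    by move: fg; rewrite (near_shift 0)/= ; apply: filterS => z; rewrite /= subr0.
  near=> h.
  have : `|(f \o shift a - (cst (f a) + 'd f a)) h| <= e%:num * `|h|.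
    by near: h; exact: H.
  by rewrite !fctE/= (nbhs_singleton fg) (near fg0 h).
have gf := diff_unique dfc E.
by apply/diff_locallyP; split; rewrite gf.
Unshelve. all: by end_near. Qed.

Section smooth_functions.
Variables (R : realType) (k : nat).
Implicit Types (U : set 'rV[R]_k) (f g : 'rV[R]_k -> R).

(** Iterated derivatives along at most [r] directions are differentiable on [U]. Bounding the order
    makes the product and inverse rules provable by induction on [r], since they express a
    derivative through functions known at the lower order. *)
Fixpoint cdiff (r : nat) U f : Prop :=
  (forall q, U q -> differentiable f q) /\
  (if r is r'.+1 then forall v, cdiff r' U ('D_v f) else True).

Definition csmooth U f := forall r, cdiff r U f.

Lemma cdiff_differentiable r U f q : cdiff r U f -> U q -> differentiable f q.
Proof. by case: r => [|r] [] H _; exact: H. Qed.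

Lemma cdiff_derivable r U f q v : cdiff r U f -> U q -> derivable f q v.
Proof. by move=> Hf Uq; apply: diff_derivable; exact: cdiff_differentiable Hf Uq. Qed.

Lemma cdiffW r U f : cdiff r.+1 U f -> cdiff r U f.
Proof.
elim: r f => [|r IH] f; first by case.
by move=> [df Df]; split => // v; apply: IH; exact: Df.
Qed.

(** Formulas for derivatives hold only on [U]; this is what allows replacing a derivative by its
    formula inside the inductions below. *)
Lemma cdiff_eq r U f g : open U -> (forall q, U q -> f q = g q) ->
  cdiff r U f -> cdiff r U g.
Proof.
move=> oU; elim: r f g => [|r IH] f g fg [df Df]; split => //.
- move=> q Uq; apply: near_eq_differentiable (df _ Uq).
  by near=> z; apply: fg; near: z; exact: open_nbhs_nbhs.
- move=> q Uq; apply: near_eq_differentiable (df _ Uq).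
  by near=> z; apply: fg; near: z; exact: open_nbhs_nbhs.
move=> v; apply: IH (Df v) => q Uq; apply: near_eq_derive.
by near=> z; apply: fg; near: z; exact: open_nbhs_nbhs.
Unshelve. all: by end_near. Qed.

Lemma csmooth_eq U f g : open U -> (forall q, U q -> f q = g q) ->
  csmooth U f -> csmooth U g.
Proof. by move=> oU fg Hf r; exact: cdiff_eq (Hf r). Qed.

Lemma cdiff_cst r U (a : R) : open U -> cdiff r U (cst a).
Proof.
move=> oU; elim: r a => [|r IH] a; split => //.
by move=> v; apply: (cdiff_eq oU _ (IH 0)) => q _ /=; rewrite derive_cst.
Qed.

Lemma cdiffD r U f g : open U -> cdiff r U f -> cdiff r U g ->
  cdiff r U (fun q => f q + g q).
Proof.
move=> oU; elim: r f g => [|r IH] f g [df Df] [dg Dg]; split => //.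
- by move=> q Uq; apply: differentiableD; [exact: df|exact: dg].
- by move=> q Uq; apply: differentiableD; [exact: df|exact: dg].
move=> v; apply: (cdiff_eq oU _ (IH _ _ (Df v) (Dg v))) => q Uq /=.
by rewrite deriveD//; apply: diff_derivable; [exact: df|exact: dg].
Qed.

Lemma cdiffM r U f g : open U -> cdiff r U f -> cdiff r U g ->
  cdiff r U (fun q => f q * g q).
Proof.
move=> oU; elim: r f g => [|r IH] f g Hf Hg; have [df Df] := Hf;
  have [dg Dg] := Hg; split => //.
- by move=> q Uq; apply: differentiableM; [exact: df|exact: dg].
- by move=> q Uq; apply: differentiableM; [exact: df|exact: dg].
move=> v; apply: (cdiff_eq oU _ (cdiffD oU (IH _ _ (cdiffW Hf) (Dg v))
   (IH _ _ (cdiffW Hg) (Df v)))) => q Uq /=.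
by rewrite deriveM//; apply: diff_derivable; [exact: df|exact: dg].
Qed.

Lemma cdiffV r U f : open U -> (forall q, U q -> f q != 0) -> cdiff r U f ->
  cdiff r U (fun q => (f q)^-1).
Proof.
move=> oU f0; elim: r => [|r IH] Hf; have [df Df] := Hf; split => //.
- by move=> q Uq; apply: differentiableV; [exact: df|exact: f0].
- by move=> q Uq; apply: differentiableV; [exact: df|exact: f0].
(* The derivative of 1/f is -(1/f)(1/f) D_v f, where 1/f is needed only at order [r]. *)
move=> v; have HV := IH (cdiffW Hf).
apply: (cdiff_eq oU _ (cdiffM oU (cdiffM oU (cdiff_cst r (-1) oU)
  (cdiffM oU HV HV)) (Df v))) => q Uq /=.
rewrite deriveV//; [|exact: f0|by apply: diff_derivable; exact: df].
by rewrite mulN1r -invfM -expr2.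
Qed.

Lemma csmooth_cst U (a : R) : open U -> csmooth U (cst a).
Proof. by move=> oU r; exact: cdiff_cst. Qed.

Lemma csmoothD U f g : open U -> csmooth U f -> csmooth U g ->
  csmooth U (fun q => f q + g q).
Proof. by move=> oU Hf Hg r; exact: cdiffD. Qed.

Lemma csmoothM U f g : open U -> csmooth U f -> csmooth U g ->
  csmooth U (fun q => f q * g q).
Proof. by move=> oU Hf Hg r; exact: cdiffM. Qed.

Lemma csmoothV U f : open U -> (forall q, U q -> f q != 0) -> csmooth U f ->
  csmooth U (fun q => (f q)^-1).
Proof. by move=> oU f0 Hf r; exact: cdiffV. Qed.

Lemma csmooth_derive U f v : csmooth U f -> csmooth U ('D_v f).
Proof. by move=> Hf r; have [_] := Hf r.+1; exact. Qed.

Lemma csmooth_derivable U f q v : csmooth U f -> U q -> derivable f q v.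
Proof. by move=> Hf; exact: (cdiff_derivable (Hf 0%N)). Qed.

Lemma csmooth_sum U (I : Type) (s : seq I) (F : I -> 'rV[R]_k -> R) :
  open U -> (forall i, csmooth U (F i)) ->
  csmooth U (fun q => \sum_(i <- s) F i q).
Proof.
move=> oU HF; elim: s => [|i s IH].
  by apply: (csmooth_eq oU _ (csmooth_cst 0 oU)) => q _; rewrite big_nil.
by apply: (csmooth_eq oU _ (csmoothD oU (HF i) IH)) => q _; rewrite big_cons.
Qed.

Lemma cdiff_locally r U f : open U ->
  (forall q, U q -> exists2 V, open V /\ V q & cdiff r V f) -> cdiff r U f.
Proof.
move=> oU; elim: r f => [|r IH] f Hf; split => //.
- by move=> q /Hf[V [oV Vq]] HV; exact: cdiff_differentiable HV Vq.
- by move=> q /Hf[V [oV Vq]] HV; exact: cdiff_differentiable HV Vq.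
by move=> v; apply: IH => q /Hf[V [oV Vq]] [_ HV]; exists V; [split|exact: HV].
Qed.

(** A continuous function without zeros has locally constant sign, and smoothness is local; [U] may
    be disconnected. *)
Lemma csmooth_sg U f : open U -> (forall q, U q -> f q != 0) -> csmooth U f ->
  csmooth U (fun q => Num.sg (f q)).
Proof.
move=> oU f0 Hf r; apply: cdiff_locally => // q Uq.
have cf : {for q, continuous f}.
  exact: differentiable_continuous (cdiff_differentiable (Hf 0%N) Uq).
have : \forall z \near q, Num.sg (f q) = Num.sg (f z).
  have [fq|fq|/eqP] := ltgtP (f q) 0; last by rewrite (negPf (f0 _ Uq)).
  - near=> z; rewrite !ltr0_sg//; near: z.
    exact: (cvgr_lt (f q)).
  - near=> z; rewrite !gtr0_sg//; near: z.
    exact: (cvgr_gt (f q)).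
pose A := [set z | Num.sg (f q) = Num.sg (f z)] => qA.
exists A^°; first by split; [exact: open_interior|exact: qA].
apply: (cdiff_eq (@open_interior _ A) (@interior_subset _ A)); exact: cdiff_cst (@open_interior _ A).
Unshelve. all: by end_near. Qed.

Lemma derive_coord (m : nat) (f : 'rV[R]_k -> 'rV[R]_m) q v j :
  derivable f q v -> ('D_v f q) 0 j = 'D_v (fun z => f z 0 j) q.
Proof. by move=> df; rewrite derive_mx// mxE. Qed.

Lemma differentiable_rowP (m : nat) (f : 'rV[R]_k -> 'rV[R]_m) q :
  differentiable f q <-> forall j, differentiable (fun z => f z 0 j) q.
Proof.
split=> [df j|df].
  exact: (differentiable_comp df (differentiable_coord _ 0 j)).
have -> : f = \sum_(j < m) (fun z => f z 0 j *: delta_mx 0 j).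
  by apply/funext => z; rewrite fct_sumE -row_sum_delta.
by apply: differentiable_sum => j; exact: differentiableZl.
Qed.

(** Passes to scalar coordinates, where the closure rules above apply. [iter_derive] takes the last
    direction of the list first, hence the splitting of lists at their end. *)
Lemma smooth_onP (m : nat) U (f : 'rV[R]_k -> 'rV[R]_m) : open U ->
  smooth_on U f <-> forall j, csmooth U (fun z => f z 0 j).
Proof.
move=> oU; split=> [Hf j r|Hf vs].
  elim: r f Hf => [|r IH] f Hf; split => //.
  - by move=> q Uq; apply: (differentiable_rowP f q).1 (Hf [::] q Uq) j.
  - by move=> q Uq; apply: (differentiable_rowP f q).1 (Hf [::] q Uq) j.
  move=> v; apply: (cdiff_eq oU _ (IH ('D_v f) _)) => [q Uq|vs q Uq].
    by rewrite -derive_coord//; apply: diff_derivable; exact: (Hf [::]).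
  by have := Hf (rcons vs v) q Uq; rewrite /iter_derive foldr_rcons.
elim/last_ind: vs f Hf => [|vs v IH] f Hf q Uq.
  by apply/differentiable_rowP => j; exact: (cdiff_differentiable (Hf j 0%N)).
rewrite /iter_derive foldr_rcons; apply: IH => // j.
apply: (csmooth_eq oU _ (csmooth_derive v (Hf j))) => z Uz.
rewrite derive_coord//; apply: diff_derivable; apply/differentiable_rowP => i.
exact: (cdiff_differentiable (Hf i 0%N)).
Qed.

End smooth_functions.
(** * Conformal principal curvatures of similar matrices *)

Section conformal_curvature_similarity.
Variable R : realType.

Lemma char_poly_similar (n : nat) (Q P h : 'M[R]_n) :
  Q *m P = 1%:M -> char_poly (Q *m h *m P) = char_poly h.
Proof.
move=> QP; have QP' : map_mx polyC Q *m map_mx polyC P = 1%:M.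
  by rewrite -map_mxM QP map_mx1.
have -> : char_poly (Q *m h *m P) =
    \det (map_mx polyC Q *m char_poly_mx h *m map_mx polyC P).
  rewrite /char_poly /char_poly_mx mulmxBr mulmxBl; congr (\det (_ - _)).
    by rewrite mul_mx_scalar -scalemxAl QP' scalemx1.
  by rewrite !map_mxM.
by rewrite !det_mulmx mulrAC -det_mulmx QP' det1 mul1r.
Qed.

(** With s = (X - al)/a one has X - (a h + al) = a (s - h), so the characteristic polynomial is a^n
    times that of [h] composed with s. *)
Lemma char_poly_affine (n : nat) (h : 'M[R]_n) (a al : R) (l : 'I_n -> R) :
  a != 0 -> char_poly h = \prod_(i < n) ('X - (l i)%:P) ->
  char_poly (a *: h + al%:M) = \prod_(i < n) ('X - (a * l i + al)%:P).
Proof.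
move=> a0 hl; pose s : {poly R} := a^-1 *: ('X - al%:P).
have as_ : a%:P * s = 'X - al%:P by rewrite mul_polyC scalerA divff// scale1r.
have -> : char_poly (a *: h + al%:M) =
    \det (a%:P *: map_mx (comp_poly s) (char_poly_mx h)).
  rewrite /char_poly; congr (\det _); apply/matrixP => i j.
  rewrite !mxE rmorphB/= rmorphMn/= comp_polyX comp_polyC mulrBr mulrnAr as_.
  by case: (i == j); rewrite ?mulr1n ?mulr0n ?addr0 ?sub0r ?polyCD ?polyCM//; ring.
rewrite detZ det_map_mx/= -/(char_poly h) hl rmorph_prod/=.
rewrite -[n in _ ^+ n]card_ord -prodr_const -big_split/=.
apply: eq_bigr => i _.
by rewrite rmorphB/= comp_polyX comp_polyC mulrBr as_ polyCD polyCM; ring.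
Qed.

Section fixed_size.
Variable n : nat.
Implicit Types (h : 'M[R]_n).

Lemma mean_curvatureE h : mean_curvature h = n%:R^-1 * \tr h.
Proof. by []. Qed.

Lemma norm2_IIE h : norm2_II h = \tr (h *m h^T).
Proof.
rewrite /norm2_II /mxtrace; apply: eq_bigr => i _; rewrite mxE.
by apply: eq_bigr => j _; rewrite mxE expr2.
Qed.

Lemma norm2_II_ge0 h : 0 <= norm2_II h.
Proof. by apply: sumr_ge0 => i _; apply: sumr_ge0 => j _; exact: sqr_ge0. Qed.

Lemma norm2_II_eq0 h : norm2_II h = 0 -> h = 0.
Proof.
move=> /eqP; rewrite psumr_eq0; last first.
  by move=> i _; apply: sumr_ge0 => j _; exact: sqr_ge0.
move=> /allP H; apply/matrixP => i j; have := H i (mem_index_enum _).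
rewrite psumr_eq0 => [/allP/(_ j (mem_index_enum _))|k _]; last exact: sqr_ge0.
by rewrite /= sqrf_eq0 mxE => /eqP.
Qed.

Lemma norm2_II_addM h (t : R) :
  norm2_II (h + t%:M) = norm2_II h + 2 * t * \tr h + n%:R * t ^+ 2.
Proof.
rewrite !norm2_IIE linearD/= tr_scalar_mx mulmxDl !mulmxDr -scalar_mxM.
rewrite mul_mx_scalar mul_scalar_mx !mxtraceD !mxtraceZ mxtrace_tr mxtrace_scalar.
rewrite -mulr_natl; ring.
Qed.

(** The quantity under the logarithm in [tau], up to the factor n/(n-1). For n > 0 it is the squared
    norm of the traceless part of [h], so a shift by a scalar matrix does not affect it. *)
Definition traceless_norm2 h : R := norm2_II h - n%:R * mean_curvature h ^+ 2.

Hypothesis n_gt0 : (0 < n)%N.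

Let n0 : n%:R != 0 :> R. Proof. by rewrite pnatr_eq0 -lt0n. Qed.

Lemma mxtrace_mean h : \tr h = n%:R * mean_curvature h.
Proof. by rewrite mean_curvatureE mulrA divff// mul1r. Qed.

Lemma traceless_norm2E h :
  traceless_norm2 h = norm2_II (h - (mean_curvature h)%:M).
Proof.
rewrite -[in RHS](rmorphN (@scalar_mx R n))/= norm2_II_addM mxtrace_mean.
rewrite /traceless_norm2; ring.
Qed.

(** The logarithm in [tau] is additive only on positive numbers; non-umbilicity enters here. *)
Lemma traceless_norm2_gt0 h :
  ~ (exists t, h = t%:M) -> 0 < traceless_norm2 h.
Proof.
move=> hN; rewrite lt0r traceless_norm2E norm2_II_ge0 andbT.
apply/eqP => /norm2_II_eq0 /eqP; rewrite subr_eq0 => /eqP hE.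
by apply: hN; exists (mean_curvature h).
Qed.

End fixed_size.

Section similar.
Variables (n : nat) (Q h h' : 'M[R]_n) (a al : R).
Hypotheses (a_gt0 : 0 < a) (QQ : Q *m Q^T = 1%:M).
Hypothesis hE : h' = a *: (Q *m h *m Q^T) + al%:M.
Hypothesis h_nonscalar : ~ (exists t, h = t%:M).

(** Matrices of size 0 or 1 are scalar. The bound makes the factor n/(n-1) in [tau] positive. *)
Lemma nonscalar_gt1 : (1 < n)%N.
Proof.
move: h h_nonscalar; case: n => [|[|m]] // g H; exfalso; apply: H.
  by exists 0; apply/matrixP => -[].
by exists (g 0 0); apply/matrixP => i j; rewrite !ord1 mxE eqxx mulr1n.
Qed.

Let n_gt0 : (0 < n)%N. Proof. exact: ltnW nonscalar_gt1. Qed.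

Let n0 : n%:R != 0 :> R. Proof. by rewrite pnatr_eq0 -lt0n. Qed.

Let QQ' : Q^T *m Q = 1%:M. Proof. exact: mulmx1C. Qed.

Let tr_conj : \tr (Q *m h *m Q^T) = \tr h.
Proof. by rewrite mxtrace_mulC mulmxA QQ' mul1mx. Qed.

Lemma mean_curvature_similar :
  mean_curvature h' = a * mean_curvature h + al.
Proof.
rewrite hE !mean_curvatureE mxtraceD mxtraceZ tr_conj mxtrace_scalar.
by rewrite -[al *+ n]mulr_natl mulrDr [_ * (_ * al)]mulrA mulVf// mul1r mulrCA.
Qed.

Lemma traceless_norm2_similar :
  traceless_norm2 h' = a ^+ 2 * traceless_norm2 h.
Proof.
rewrite /traceless_norm2 mean_curvature_similar hE norm2_II_addM mxtraceZ.
rewrite tr_conj mxtrace_mean//.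
have -> : norm2_II (a *: (Q *m h *m Q^T)) = a ^+ 2 * norm2_II h.
  rewrite !norm2_IIE linearZ/= -scalemxAl -scalemxAr scalerA mxtraceZ expr2.
  congr (_ * _); rewrite !trmx_mul trmxK -!mulmxA [Q^T *m (Q *m _)]mulmxA QQ' mul1mx.
  by rewrite mxtrace_mulC -!mulmxA QQ' mulmx1.
ring.
Qed.

Lemma tau_similar : tau h' = tau h + ln a.
Proof.
rewrite /tau -/(traceless_norm2 h') -/(traceless_norm2 h) traceless_norm2_similar.
have D0 := traceless_norm2_gt0 n_gt0 h_nonscalar.
have n1 : 0 < n%:R / (n%:R - 1) :> R.
  by rewrite divr_gt0 ?ltr0n// subr_gt0 ltr1n nonscalar_gt1.
rewrite mulrCA [in LHS]lnM ?posrE ?exprn_gt0 ?(mulr_gt0 n1)// lnXn//.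
rewrite mulrDl addrC -[ln a *+ 2]mulr_natr mulfK//; by rewrite pnatr_eq0.
Qed.

(** The shift [al] cancels in l - H, which is multiplied by [a], while exp(-tau) is divided by
    [a]. *)
Lemma conformal_curvature_similar (l : R) :
  conformal_curvature h' (a * l + al) = conformal_curvature h l.
Proof.
rewrite /conformal_curvature tau_similar mean_curvature_similar opprD expRD.
rewrite [expR (- ln a)]expRN lnK ?posrE//.
rewrite -mulrA; congr (_ * _); field; exact: lt0r_neq0.
Qed.

Lemma principal_curvatures_similar (l : 'I_n -> R) :
  principal_curvatures h l -> principal_curvatures h' (fun i => a * l i + al).
Proof.
move=> hl; rewrite /principal_curvatures hE; apply: char_poly_affine.
  exact: lt0r_neq0.
by rewrite char_poly_similar.
Qed.

Lemma conformal_curvatures_similar (b : 'I_n -> R) :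
  conformal_curvatures h b -> conformal_curvatures h' b.
Proof.
move=> [l [hl bl]]; exists (fun i => a * l i + al); split => [|i].
  exact: principal_curvatures_similar.
by rewrite bl conformal_curvature_similar.
Qed.

Lemma similar_nonscalar : ~ (exists t, h' = t%:M).
Proof.
move=> [t ht]; apply: h_nonscalar; exists (a^-1 * (t - al)).
have : a *: (Q *m h *m Q^T) = (t - al)%:M.
  by rewrite rmorphB/= -ht hE addrK.
move=> /(congr1 (fun A => Q^T *m (a^-1 *: A) *m Q)).
rewrite scalerA mulVf ?lt0r_neq0// scale1r scale_scalar_mx mul_mx_scalar.
by rewrite -scalemxAl QQ' scalemx1 !mulmxA QQ' mul1mx -mulmxA QQ' mulmx1.
Qed.

(** The relation is symmetric, which reduces the converse implication between conformal curvatures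
    to the direct one. *)
Lemma similar_sym : h = a^-1 *: (Q^T *m h' *m Q^T^T) + (- (al / a))%:M.
Proof.
rewrite hE trmxK mulmxDr mulmxDl scalerDr mul_mx_scalar -!scalemxAr -!scalemxAl.
rewrite scalerA mulVf ?lt0r_neq0// scale1r QQ' scalerA.
rewrite !mulmxA QQ' mul1mx -mulmxA QQ' mulmx1 -addrA scalemx1 -rmorphD/=.
by rewrite mulrC subrr rmorph0 addr0.
Qed.

End similar.

Lemma conformal_curvatures_similarP (n : nat) (Q h h' : 'M[R]_n) (a al : R)
    (b : 'I_n -> R) :
  0 < a -> Q *m Q^T = 1%:M -> h' = a *: (Q *m h *m Q^T) + al%:M ->
  ~ (exists t, h = t%:M) ->
  conformal_curvatures h b <-> conformal_curvatures h' b.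
Proof.
move=> a0 QQ hE hN; split; first exact: (conformal_curvatures_similar a0 QQ hE).
have QQ' : Q^T *m Q^T^T = 1%:M by rewrite trmxK mulmx1C.
apply: (conformal_curvatures_similar _ QQ' (similar_sym a0 QQ hE)).
  by rewrite invr_gt0.
exact: (similar_nonscalar a0 QQ hE).
Qed.

End conformal_curvature_similarity.

(** * Derivatives and smoothness of vector-valued maps *)

Section vector_calculus.
Variables (R : realType) (k : nat).
Implicit Types (U : set 'rV[R]_k) (q v : 'rV[R]_k).

Lemma derive_eq_on (W : normedModType R) U (f g : 'rV[R]_k -> W) q v :
  open U -> (forall z, U z -> f z = g z) -> U q -> 'D_v f q = 'D_v g q.
Proof.
move=> oU fg Uq; apply: near_eq_derive.
by near=> z; apply: fg; near: z; exact: open_nbhs_nbhs.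
Unshelve. all: by end_near. Qed.

Lemma smooth_on_derivable (m : nat) U (f : 'rV[R]_k -> 'rV[R]_m) q v :
  smooth_on U f -> U q -> derivable f q v.
Proof. by move=> Hf Uq; apply: diff_derivable; exact: (Hf [::]). Qed.

Lemma smooth_on_derive (m : nat) U (f : 'rV[R]_k -> 'rV[R]_m) v :
  smooth_on U f -> smooth_on U ('D_v f).
Proof.
by move=> Hf vs q Uq; have := Hf (rcons vs v) q Uq; rewrite /iter_derive foldr_rcons.
Qed.

Lemma derive_sum_fun (I : Type) (s : seq I) (h : I -> 'rV[R]_k -> R) q v :
  (forall i, derivable (h i) q v) ->
  'D_v (fun z => \sum_(i <- s) h i z) q = \sum_(i <- s) 'D_v (h i) q.
Proof.
move=> hd; suff [] : derivable (fun z => \sum_(i <- s) h i z) q v /\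
  'D_v (fun z => \sum_(i <- s) h i z) q = \sum_(i <- s) 'D_v (h i) q by [].
elim: s => [|i s [IHd IH]].
  have -> : (fun z => \sum_(i <- [::]) h i z) = cst 0.
    by apply/funext => z; rewrite big_nil.
  by rewrite big_nil derive_cst; split => //; exact: derivable_cst.
have -> : (fun z => \sum_(j <- i :: s) h j z) =
   h i + (fun z => \sum_(i <- s) h i z).
  by apply/funext => z; rewrite big_cons.
split; first exact: (derivableD (hd i) IHd).
by rewrite (deriveD (hd i) IHd) IH big_cons.
Qed.

Lemma derive_scale (m : nat) (a : 'rV[R]_k -> R) (f : 'rV[R]_k -> 'rV[R]_m) q v :
  derivable a q v -> derivable f q v ->
  'D_v (fun z => a z *: f z) q = 'D_v a q *: f q + a q *: 'D_v f q.
Proof.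
move=> da df; have df' := (derivable_mxP f q v).1 df.
have dM j : derivable (fun z => (a z *: f z) 0 j) q v.
  have -> : (fun z => (a z *: f z) 0 j) = a * (fun z => f z 0 j).
    by apply/funext => z; rewrite mxE.
  exact: (derivableM da (df' 0 j)).
have dS : derivable (fun z => a z *: f z) q v.
  by apply/derivable_mxP => i j; rewrite ord1; exact: dM.
apply/rowP => j; rewrite (derive_coord j dS) !mxE (derive_coord j df).
have -> : (fun z => (a z *: f z) 0 j) = a * (fun z => f z 0 j).
  by apply/funext => z; rewrite mxE.
rewrite (deriveM da (df' 0 j)) addrC; congr (_ + _); exact: mulrC.
Qed.

Lemma derive_mulmx (m p : nat) (A : 'M[R]_(m, p)) (f : 'rV[R]_k -> 'rV[R]_m) q v :
  derivable f q v ->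
  'D_v (fun z => f z *m A) q = 'D_v f q *m A.
Proof.
move=> df; have df' := (derivable_mxP f q v).1 df.
have E j : (fun z => (f z *m A) 0 j) = (fun z => \sum_i f z 0 i * A i j).
  by apply/funext => z; rewrite mxE.
have dA i j : derivable (fun z => f z 0 i * A i j) q v.
  exact: (derivableM (df' _ _) (derivable_cst _ _ _)).
have dM j : derivable (fun z => (f z *m A) 0 j) q v.
  rewrite E; have -> : (fun z => \sum_i f z 0 i * A i j) =
      \sum_i (fun z => f z 0 i * A i j).
    by apply/funext => z; rewrite fct_sumE.
  by apply: derivable_sum => i.
have dS : derivable (fun z => f z *m A) q v.
  by apply/derivable_mxP => i j; rewrite ord1; exact: dM.
apply/rowP => j; rewrite (derive_coord j dS) !mxE E.
rewrite (derive_sum_fun _ (dA^~ j)); apply: eq_bigr => i _.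
rewrite (derive_coord i df) (deriveM (df' 0 i) (derivable_cst (A i j) _ _)).
by rewrite derive_cst scaler0 add0r mulrC.
Qed.

Lemma smooth_on_mulmx (m p : nat) (A : 'M[R]_(m, p)) U (f : 'rV[R]_k -> 'rV[R]_m) :
  open U -> smooth_on U f -> smooth_on U (fun z => f z *m A).
Proof.
move=> oU /(smooth_onP _ oU) Hf; apply/(smooth_onP _ oU) => j.
apply: (csmooth_eq oU _ (@csmooth_sum _ _ _ _ (index_enum 'I_m)
  (fun i z => f z 0 i * A i j) oU _)) => [z _|i].
  by rewrite mxE.
exact: csmoothM (csmooth_cst _ oU).
Qed.

Lemma smooth_on_scale (m : nat) U (a : 'rV[R]_k -> R) (f : 'rV[R]_k -> 'rV[R]_m) :
  open U -> csmooth U a -> smooth_on U f -> smooth_on U (fun z => a z *: f z).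
Proof.
move=> oU Ha /(smooth_onP _ oU) Hf; apply/(smooth_onP _ oU) => j.
by apply: (csmooth_eq oU _ (csmoothM oU Ha (Hf j))) => z _; rewrite mxE.
Qed.

Lemma smooth_onB (m : nat) U (f g : 'rV[R]_k -> 'rV[R]_m) :
  open U -> smooth_on U f -> smooth_on U g -> smooth_on U (fun z => f z - g z).
Proof.
move=> oU /(smooth_onP _ oU) Hf /(smooth_onP _ oU) Hg; apply/(smooth_onP _ oU) => j.
apply: (csmooth_eq oU _ (csmoothD oU (Hf j)
  (csmoothM oU (csmooth_cst (-1) oU) (Hg j)))) => z _.
by rewrite !mxE mulN1r.
Qed.

Lemma smooth_on_eq (m : nat) U (f g : 'rV[R]_k -> 'rV[R]_m) :
  open U -> (forall z, U z -> f z = g z) -> smooth_on U f -> smooth_on U g.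
Proof.
move=> oU fg /(smooth_onP _ oU) Hf; apply/(smooth_onP _ oU) => j.
by apply: (csmooth_eq oU _ (Hf j)) => z /fg ->.
Qed.

End vector_calculus.

(** * The indefinite scalar product and its isometries *)

Section scalar_product.
Variables (R : realType) (s m : nat).
Implicit Types P W X Y Z : 'rV[R]_m.

Lemma sformC X Y : sform s X Y = sform s Y X.
Proof. by apply: eq_bigr => i _; rewrite [X 0 i * _]mulrC. Qed.

Lemma sformDl X Y Z : sform s (X + Y) Z = sform s X Z + sform s Y Z.
Proof. by rewrite -big_split; apply: eq_bigr => i _; rewrite mxE mulrDl mulrDr. Qed.

Lemma sformZl a X Z : sform s (a *: X) Z = a * sform s X Z.
Proof.
by rewrite /sform mulr_sumr; apply: eq_bigr => i _; rewrite mxE -mulrA mulrCA.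
Qed.

Lemma sformNl X Z : sform s (- X) Z = - sform s X Z.
Proof. by rewrite -scaleN1r sformZl mulN1r. Qed.

Lemma sformBl X Y Z : sform s (X - Y) Z = sform s X Z - sform s Y Z.
Proof. by rewrite sformDl sformNl. Qed.

Lemma sform0l Z : sform s 0 Z = 0.
Proof. by rewrite -[0](scale0r 0) sformZl mul0r. Qed.

Lemma sformDr X Y Z : sform s Z (X + Y) = sform s Z X + sform s Z Y.
Proof. by rewrite sformC sformDl !(sformC _ Z). Qed.

Lemma sformZr a X Z : sform s Z (a *: X) = a * sform s Z X.
Proof. by rewrite sformC sformZl sformC. Qed.

Lemma sformBr X Y Z : sform s Z (X - Y) = sform s Z X - sform s Z Y.
Proof. by rewrite sformC sformBl !(sformC _ Z). Qed.

(** Used with P = G and X, Y derivatives of G: the derivatives of k multiply the null vector G only,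
    so they leave no trace in the metric. *)
Lemma sform_null_add P X Y (a b t : R) :
  sform s P P = 0 -> sform s X P = 0 -> sform s Y P = 0 ->
  sform s (a *: P + t *: X) (b *: P + t *: Y) = t ^+ 2 * sform s X Y.
Proof.
move=> P0 XP YP; rewrite !sformDl !sformDr !sformZl !sformZr P0 XP [sform s P Y]sformC YP.
by rewrite !mulr0 !add0r mulrA expr2.
Qed.

(** The left argument has the shape of the Leibniz expansion of a second derivative of k G; a vector
    [W] normal to G and to its first derivatives sees only the last term. *)
Lemma sform_combination W P X Y Z (a b d t : R) :
  sform s P W = 0 -> sform s X W = 0 -> sform s Y W = 0 ->
  sform s ((a *: P + b *: X) + (d *: Y + t *: Z)) W = t * sform s Z W.
Proof.
by move=> PW XW YW; rewrite !sformDl !sformZl PW XW YW !mulr0 !add0r.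
Qed.

Lemma sform_nondegenerate X : (forall Y, sform s X Y = 0) -> X = 0.
Proof.
move=> H; apply/rowP => i; have := H (delta_mx 0 i).
rewrite /sform (bigD1 i)//= big1 => [|j /negPf ji]; last by rewrite !mxE eqxx ji !mulr0.
by rewrite !mxE !eqxx addr0 mulr1 => /eqP; rewrite mulf_eq0 signr_eq0 => /eqP.
Qed.

Lemma derive_sform (k : nat) (f g : 'rV[R]_k -> 'rV[R]_m) q v :
  derivable f q v -> derivable g q v ->
  'D_v (fun z => sform s (f z) (g z)) q =
  sform s ('D_v f q) (g q) + sform s (f q) ('D_v g q).
Proof.
move=> df dg; have df' := (derivable_mxP f q v).1 df.
have dg' := (derivable_mxP g q v).1 dg.
have dfg i : derivable ((fun z => f z 0 i) * (fun z => g z 0 i)) q v.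
  exact: (derivableM (df' 0 i) (dg' 0 i)).
rewrite /sform derive_sum_fun => [|i]; last first.
  exact: (derivableM (derivable_cst _ _ _) (dfg i)).
rewrite -big_split; apply: eq_bigr => i _ /=.
rewrite (deriveM (derivable_cst _ _ _) (dfg i)) derive_cst scaler0 addr0.
rewrite (deriveM (df' 0 i) (dg' 0 i)) (derive_coord i df) (derive_coord i dg).
rewrite -mulrDr; congr (_ * _); rewrite addrC; congr (_ + _); exact: mulrC.
Qed.

Lemma csmooth_sform (k : nat) (U : set 'rV[R]_k) (f g : 'rV[R]_k -> 'rV[R]_m) :
  open U -> smooth_on U f -> smooth_on U g ->
  csmooth U (fun z => sform s (f z) (g z)).
Proof.
move=> oU /(smooth_onP _ oU) Hf /(smooth_onP _ oU) Hg.
apply: csmooth_sum => // i; apply: (csmoothM oU (csmooth_cst _ oU)).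
exact: csmoothM.
Qed.

(** A row vector killed by [T] is orthogonal to everything, hence zero by nondegeneracy. *)
Lemma orthogonal_unitmx (T : 'M[R]_m) : orthogonal_group s T -> T \in unitmx.
Proof.
move=> oT; rewrite -row_free_unit -kermx_eq0; apply/eqP/row_matrixP => i.
rewrite row0; apply: sform_nondegenerate => Y; rewrite -oT.
by rewrite -row_mul mulmx_ker row0 sform0l.
Qed.

Lemma orthogonal_invmx (T : 'M[R]_m) :
  orthogonal_group s T -> orthogonal_group s (invmx T).
Proof.
move=> oT X Y; have Tu := orthogonal_unitmx oT.
by rewrite -oT !mulmxKV.
Qed.

End scalar_product.
(** * Light-cone lifts *)

Section row_extension.
Variables (R : realType) (m : nat).
Implicit Types (u w : 'rV[R]_m) (t : R).

Lemma cons_rv0 t u : cons_rv t u 0 ord0 = t.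
Proof. by rewrite mxE unlift_none. Qed.

Lemma cons_rv_lift t u i : cons_rv t u 0 (lift ord0 i) = u 0 i.
Proof. by rewrite mxE liftK. Qed.

Lemma rcons_rv_max u t : rcons_rv u t 0 ord_max = t.
Proof. by rewrite mxE unlift_none. Qed.

Lemma rcons_rv_lift u t i : rcons_rv u t 0 (lift ord_max i) = u 0 i.
Proof. by rewrite mxE liftK. Qed.

(** Dropping a coordinate is written as multiplication by a constant matrix, so that it commutes
    with derivatives. *)
Lemma mul_col'1 (i : 'I_m.+1) (Y : 'rV[R]_m.+1) :
  Y *m col' i 1%:M = \row_j Y 0 (lift i j).
Proof. by apply/rowP => j; rewrite -{2}[Y]mulmx1 !mxE; apply: eq_bigr => l _; rewrite mxE. Qed.

Lemma cons_rv_behead t u : cons_rv t u *m col' ord0 1%:M = u.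
Proof. by rewrite mul_col'1; apply/rowP => j; rewrite mxE cons_rv_lift. Qed.

Lemma rcons_rv_belast u t : rcons_rv u t *m col' ord_max 1%:M = u.
Proof. by rewrite mul_col'1; apply/rowP => j; rewrite mxE rcons_rv_lift. Qed.

Lemma cons_rv_eta (Y : 'rV[R]_m.+1) : Y = cons_rv (Y 0 ord0) (Y *m col' ord0 1%:M).
Proof.
apply/rowP => i; case: (unliftP ord0 i) => [j|] ->; last by rewrite cons_rv0.
by rewrite cons_rv_lift mul_col'1 mxE.
Qed.

Lemma rcons_rv_eta (Y : 'rV[R]_m.+1) :
  Y = rcons_rv (Y *m col' ord_max 1%:M) (Y 0 ord_max).
Proof.
apply/rowP => i; case: (unliftP ord_max i) => [j|] ->; last by rewrite rcons_rv_max.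
by rewrite rcons_rv_lift mul_col'1 mxE.
Qed.

Lemma mul_delta_col (Y : 'rV[R]_m.+1) i : (Y *m delta_mx i 0) = (Y 0 i)%:M :> 'M[R]_1.
Proof. by rewrite -colE; apply/matrixP => a b; rewrite !ord1 !mxE eqxx. Qed.

Lemma sform_cons s t t' u u' :
  sform s.+1 (cons_rv t u) (cons_rv t' u') = sform s u u' - t * t'.
Proof.
rewrite /sform big_ord_recl/= !cons_rv0 expr1 mulN1r addrC; congr (_ - _).
by apply: eq_bigr => i _; rewrite !cons_rv_lift.
Qed.

Lemma sform_rcons s t t' u u' : (s <= m)%N ->
  sform s (rcons_rv u t) (rcons_rv u' t') = sform s u u' + t * t'.
Proof.
move=> sm; rewrite /sform big_ord_recr/= ltnNge sm expr0 mul1r !rcons_rv_max.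
congr (_ + _); apply: eq_bigr => i _.
have -> : widen_ord (leqnSn m) i = lift ord_max i.
  by apply: val_inj; rewrite /= /bump leqNgt ltn_ord.
by rewrite !rcons_rv_lift.
Qed.

End row_extension.

Section lifts.
Variables (R : realType) (n : nat).

(* The affine slice [Y *m lift_fun c = 1] of the light cone is a copy of the
   space form, with coordinates [Y *m lift_proj c]. *)
Definition lift_fun (c : curvature) : 'cV[R]_n.+3 :=
  match c with
  | Flat => delta_mx ord0 0 - delta_mx ord_max 0
  | DeSitter => delta_mx ord0 0
  | AntiDeSitter => delta_mx ord_max 0
  end.

Definition lift_proj (c : curvature) : 'M[R]_(n.+3, amb_dim c n) :=
  match c with
  | Flat => col' ord0 1%:M *m col' ord_max 1%:M
  | DeSitter => col' ord0 1%:M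
  | AntiDeSitter => col' ord_max 1%:M
  end.

Definition lift (c : curvature) : 'rV[R]_(amb_dim c n) -> 'rV[R]_n.+3 :=
  match c with
  | Flat => fun u => cons_rv ((sform 1 u u + 1) / 2)
                             (rcons_rv u ((sform 1 u u - 1) / 2))
  | DeSitter => fun u => cons_rv 1 u
  | AntiDeSitter => fun u => rcons_rv u 1
  end.

(** The differential of [lift] at [u] applied to [e]: in the flat case both outer coordinates of
    [lift] have derivative <u, e>. *)
Definition normal_lift (c : curvature) :
    'rV[R]_(amb_dim c n) -> 'rV[R]_(amb_dim c n) -> 'rV[R]_n.+3 :=
  match c with
  | Flat => fun u e => cons_rv (sform 1 u e) (rcons_rv e (sform 1 u e))
  | DeSitter => fun _ e => cons_rv 0 e
  | AntiDeSitter => fun _ e => rcons_rv e 0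
  end.

Lemma sigmaE c (u : 'rV[R]_(amb_dim c n)) : sigma c u = proj_point (lift u).
Proof. by case: c u. Qed.

Lemma lift_proj_lift c (u : 'rV[R]_(amb_dim c n)) : lift u *m lift_proj c = u.
Proof.
by case: c u => u; rewrite /lift /lift_proj ?mulmxA ?cons_rv_behead ?rcons_rv_belast.
Qed.

Lemma flat_fun (Y : 'rV[R]_n.+3) :
  Y *m lift_fun Flat = (Y 0 ord0 - Y 0 ord_max)%:M.
Proof. by rewrite mulmxBr !mul_delta_col -rmorphB. Qed.

Lemma cons_rcons_max t t' (u : 'rV[R]_n.+1) :
  cons_rv t (rcons_rv u t') 0 ord_max = t'.
Proof.
have -> : ord_max = fintype.lift ord0 (ord_max : 'I_n.+2) by exact: val_inj.
by rewrite cons_rv_lift rcons_rv_max.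
Qed.

Lemma cons_rcons_eta (Y : 'rV[R]_n.+3) :
  Y = cons_rv (Y 0 ord0) (rcons_rv (Y *m lift_proj Flat) (Y 0 ord_max)).
Proof.
have <- : Y *m col' ord0 1%:M = rcons_rv (Y *m lift_proj Flat) (Y 0 ord_max).
  rewrite [LHS]rcons_rv_eta mulmxA; congr rcons_rv.
  by rewrite mul_col'1 mxE; congr (Y 0 _); exact: val_inj.
exact: cons_rv_eta.
Qed.

Lemma lift_fun_lift c (u : 'rV[R]_(amb_dim c n)) : lift u *m lift_fun c = 1%:M.
Proof.
case: c u => u; rewrite ?flat_fun ?mul_delta_col ?cons_rv0 ?rcons_rv_max//.
by rewrite cons_rcons_max; congr (_%:M); field.
Qed.

Lemma normal_lift_fun c (u e : 'rV[R]_(amb_dim c n)) :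
  normal_lift u e *m lift_fun c = 0.
Proof.
case: c u e => u e; rewrite ?flat_fun ?mul_delta_col ?cons_rv0 ?rcons_rv_max ?rmorph0//.
by rewrite cons_rcons_max subrr rmorph0.
Qed.

Lemma normal_lift_proj c (u e : 'rV[R]_(amb_dim c n)) :
  normal_lift u e *m lift_proj c = e.
Proof.
by case: c u e => u e; rewrite /lift_proj ?mulmxA ?cons_rv_behead ?rcons_rv_belast.
Qed.

Lemma sform_cons_rcons s s' t t' (u u' : 'rV[R]_n.+1) :
  sform 2 (cons_rv s (rcons_rv u t)) (cons_rv s' (rcons_rv u' t')) =
  sform 1 u u' + t * t' - s * s'.
Proof. by rewrite sform_cons sform_rcons. Qed.

Lemma lift_null c (u : 'rV[R]_(amb_dim c n)) :
  space_form c u -> sform 2 (lift u) (lift u) = 0.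
Proof.
case: c u => u /=.
- by move=> _; rewrite sform_cons_rcons; field.
- by rewrite /amb_form sform_cons => ->; rewrite mulr1 subrr.
- by rewrite /amb_form sform_rcons// => ->; rewrite mulr1 addNr.
Qed.

Lemma scalar_mx11_eq (a b : R) : a%:M = b%:M :> 'M[R]_1 -> a = b.
Proof. by move=> /matrixP/(_ 0 0); rewrite !mxE !mulr1n. Qed.

(** On the kernel of the linear form the coordinates that [lift_proj] drops contribute nothing: in
    the flat case they are equal and enter with opposite signs, otherwise the single dropped one is
    zero. *)
Lemma amb_form_proj c (Y Z : 'rV[R]_n.+3) :
  Y *m lift_fun c = 0 -> Z *m lift_fun c = 0 ->
  amb_form (Y *m lift_proj c) (Z *m lift_proj c) = sform 2 Y Z.
Proof.
rewrite -(rmorph0 (@scalar_mx R 1)); case: c.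
- rewrite !flat_fun => /scalar_mx11_eq/eqP; rewrite subr_eq0 => /eqP Y0.
  move=> /scalar_mx11_eq/eqP; rewrite subr_eq0 => /eqP Z0.
  rewrite [in RHS](cons_rcons_eta Y) [in RHS](cons_rcons_eta Z).
  by rewrite sform_cons_rcons Y0 Z0 addrK.
- rewrite !mul_delta_col => /scalar_mx11_eq Y0 /scalar_mx11_eq Z0.
  rewrite [in RHS](cons_rv_eta Y) [in RHS](cons_rv_eta Z) sform_cons Y0 Z0.
  by rewrite mulr0 subr0.
- rewrite !mul_delta_col => /scalar_mx11_eq Y0 /scalar_mx11_eq Z0.
  rewrite [in RHS](rcons_rv_eta Y) [in RHS](rcons_rv_eta Z) sform_rcons// Y0 Z0.
  by rewrite mulr0 addr0.
Qed.

Lemma normal_lift_orth c (u e : 'rV[R]_(amb_dim c n)) :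
  tangent_space_form u e -> sform 2 (normal_lift u e) (lift u) = 0.
Proof.
case: c u e => u e /=.
- by move=> _; rewrite sform_cons_rcons (sformC _ e); field.
- by rewrite /amb_form sform_cons sformC => ->; rewrite mul0r subrr.
- by rewrite /amb_form sform_rcons// sformC => ->; rewrite mul0r addr0.
Qed.

Lemma tangent_proj c (u : 'rV[R]_(amb_dim c n)) (N : 'rV[R]_n.+3) :
  N *m lift_fun c = 0 -> sform 2 N (lift u) = 0 ->
  tangent_space_form u (N *m lift_proj c).
Proof.
rewrite -(rmorph0 (@scalar_mx R 1)); case: c u => u //=.
- rewrite mul_delta_col => /scalar_mx11_eq N0.
  rewrite [in sform _ _ _](cons_rv_eta N) N0 sform_cons mul0r subr0.
  by rewrite /amb_form sformC.
- rewrite mul_delta_col => /scalar_mx11_eq N0.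
  rewrite [in sform _ _ _](rcons_rv_eta N) N0 sform_rcons// mul0r addr0.
  by rewrite /amb_form sformC.
Qed.

End lifts.

Section smooth_lifts.
Variables (R : realType) (n k : nat) (c : curvature) (U : set 'rV[R]_k).
Hypothesis oU : open U.

Lemma smooth_cons_rv (m : nat) (t : 'rV[R]_k -> R) (f : 'rV[R]_k -> 'rV[R]_m) :
  csmooth U t -> smooth_on U f -> smooth_on U (fun z => cons_rv (t z) (f z)).
Proof.
move=> Ht /(smooth_onP _ oU) Hf; apply/(smooth_onP _ oU) => i.
case: (unliftP ord0 i) => [j|] ->.
  by apply: (csmooth_eq oU _ (Hf j)) => z _; rewrite cons_rv_lift.
by apply: (csmooth_eq oU _ Ht) => z _; rewrite cons_rv0.
Qed.

Lemma smooth_rcons_rv (m : nat) (t : 'rV[R]_k -> R) (f : 'rV[R]_k -> 'rV[R]_m) :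
  csmooth U t -> smooth_on U f -> smooth_on U (fun z => rcons_rv (f z) (t z)).
Proof.
move=> Ht /(smooth_onP _ oU) Hf; apply/(smooth_onP _ oU) => i.
case: (unliftP ord_max i) => [j|] ->.
  by apply: (csmooth_eq oU _ (Hf j)) => z _; rewrite rcons_rv_lift.
by apply: (csmooth_eq oU _ Ht) => z _; rewrite rcons_rv_max.
Qed.

Lemma smooth_lift (f : 'rV[R]_k -> 'rV[R]_(amb_dim c n)) :
  smooth_on U f -> smooth_on U (fun z => lift (f z)).
Proof.
case: c f => f Hf.
- have Hs a : csmooth U (fun z => (sform 1 (f z) (f z) + a) / 2).
    apply: (csmoothM oU _ (csmooth_cst _ oU)).
    exact: (csmoothD oU (csmooth_sform _ oU Hf Hf) (csmooth_cst _ oU)).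
  by apply: smooth_cons_rv => //; apply: smooth_rcons_rv.
- exact: (smooth_cons_rv (csmooth_cst 1 oU)).
- exact: (smooth_rcons_rv (csmooth_cst 1 oU)).
Qed.

Lemma smooth_normal_lift (f e : 'rV[R]_k -> 'rV[R]_(amb_dim c n)) :
  smooth_on U f -> smooth_on U e -> smooth_on U (fun z => normal_lift (f z) (e z)).
Proof.
case: c f e => f e Hf He.
- have Hs := csmooth_sform 1 oU Hf He.
  by apply: smooth_cons_rv => //; apply: smooth_rcons_rv.
- exact: (smooth_cons_rv (csmooth_cst 0 oU)).
- exact: (smooth_rcons_rv (csmooth_cst 0 oU)).
Qed.

End smooth_lifts.

(** * Derivatives of the lift of a hypersurface *)

Section lifted_surface.
Variables (R : realType) (n : nat) (c : curvature) (U : set 'rV[R]_n).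
Variable f : 'rV[R]_n -> 'rV[R]_(amb_dim c n).
Hypotheses (oU : open U) (sf : smooth_on U f) (cf : forall z, space_form c (f z)).
Implicit Types (q v w : 'rV[R]_n).

Local Notation F := (fun z => lift (f z)).

Let sF : smooth_on U F. Proof. exact: smooth_lift. Qed.

Lemma derive_lift_proj q v : U q -> 'D_v F q *m lift_proj R n c = 'D_v f q.
Proof.
move=> Uq; rewrite -derive_mulmx; last exact: smooth_on_derivable sF Uq.
by congr ('D_v _ q); apply/funext => z; rewrite lift_proj_lift.
Qed.

Lemma derive_lift_fun q v : U q -> 'D_v F q *m lift_fun R n c = 0.
Proof.
move=> Uq; rewrite -derive_mulmx; last exact: smooth_on_derivable sF Uq.
rewrite [X in 'D_v X q](_ : _ = cst 1%:M) ?derive_cst//.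
by apply/funext => z; rewrite lift_fun_lift.
Qed.

Lemma derive2_lift_proj q v w : U q ->
  'D_v ('D_w F) q *m lift_proj R n c = 'D_v ('D_w f) q.
Proof.
move=> Uq; rewrite -derive_mulmx.
  by apply: derive_eq_on oU _ Uq => z Uz; exact: derive_lift_proj.
exact: smooth_on_derivable (smooth_on_derive _ sF) Uq.
Qed.

Lemma derive2_lift_fun q v w : U q -> 'D_v ('D_w F) q *m lift_fun R n c = 0.
Proof.
move=> Uq; rewrite -derive_mulmx.
  rewrite (@derive_eq_on _ _ _ U _ (cst 0)) ?derive_cst// => z Uz.
  exact: derive_lift_fun.
exact: smooth_on_derivable (smooth_on_derive _ sF) Uq.
Qed.

Lemma sform_derive_lift q v : U q -> sform 2 ('D_v F q) (F q) = 0.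
Proof.
move=> Uq; have dF := smooth_on_derivable (v := v) sF Uq.
have := derive_sform 2 dF dF.
rewrite [X in 'D_v X q](_ : _ = cst 0) ?derive_cst; last first.
  by apply/funext => z; rewrite lift_null.
rewrite [X in _ = _ + X]sformC -mulr2n => /esym/eqP.
by rewrite mulrn_eq0 => /eqP.
Qed.

(** Differentiate <D_w F, F> = 0, which holds on all of the open set [U]. *)
Lemma sform_derive2_lift q v w : U q ->
  sform 2 ('D_v ('D_w F) q) (F q) = - sform 2 ('D_v F q) ('D_w F q).
Proof.
move=> Uq; have dF := smooth_on_derivable (v := v) sF Uq.
have ddF := smooth_on_derivable (v := v) (smooth_on_derive w sF) Uq.
have Z : 'D_v (fun z => sform 2 ('D_w F z) (F z)) q = 0.
  rewrite (@derive_eq_on _ _ _ U _ (cst 0)) ?derive_cst// => z.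
  exact: sform_derive_lift.
have := derive_sform 2 ddF dF; rewrite Z => /esym E.
by rewrite (sformC 2 ('D_v F q)); apply/eqP; rewrite -addr_eq0 E.
Qed.

Lemma amb_form_derive q v w : U q ->
  amb_form ('D_v f q) ('D_w f q) = sform 2 ('D_v F q) ('D_w F q).
Proof.
by move=> Uq; rewrite -!derive_lift_proj// amb_form_proj// derive_lift_fun.
Qed.

Lemma amb_form_derive_proj q v N : U q -> N *m lift_fun R n c = 0 ->
  amb_form ('D_v f q) (N *m lift_proj R n c) = sform 2 ('D_v F q) N.
Proof.
by move=> Uq N0; rewrite -derive_lift_proj// amb_form_proj// derive_lift_fun.
Qed.

Lemma amb_form_derive2_proj q v w N : U q -> N *m lift_fun R n c = 0 ->
  amb_form ('D_v ('D_w f) q) (N *m lift_proj R n c) = sform 2 ('D_v ('D_w F) q) N.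
Proof.
by move=> Uq N0; rewrite -derive2_lift_proj// amb_form_proj// derive2_lift_fun.
Qed.

End lifted_surface.

(** * Two lifts related by an isometry and a scalar factor *)

Section conformal_pair.
Variables (R : realType) (n : nat) (c : curvature) (U : set 'rV[R]_n).
Variables (f g : 'rV[R]_n -> 'rV[R]_(amb_dim c n)) (k : 'rV[R]_n -> R).
Variable T : 'M[R]_n.+3.
Hypotheses (oU : open U) (sf : smooth_on U f) (sg : smooth_on U g).
Hypothesis cg : forall z, space_form c (g z).
Hypotheses (oT : orthogonal_group 2 T) (sk : csmooth U k).
Hypothesis fg : forall z, lift (f z) *m T = k z *: lift (g z).
Implicit Types (q v w : 'rV[R]_n).

Local Notation F := (fun z => lift (f z)).
Local Notation G := (fun z => lift (g z)).

Let sF : smooth_on U F. Proof. exact: smooth_lift. Qed.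
Let sG : smooth_on U G. Proof. exact: smooth_lift. Qed.

Lemma derive_pair q v : U q ->
  'D_v F q *m T = 'D_v k q *: G q + k q *: 'D_v G q.
Proof.
move=> Uq; rewrite -derive_mulmx; last exact: smooth_on_derivable sF Uq.
rewrite -derive_scale; first by congr ('D_v _ q); apply/funext.
  exact: csmooth_derivable sk Uq.
exact: smooth_on_derivable sG Uq.
Qed.

Lemma derive2_pair q v w : U q ->
  'D_v ('D_w F) q *m T =
    ('D_v ('D_w k) q *: G q + 'D_w k q *: 'D_v G q) +
    ('D_v k q *: 'D_w G q + k q *: 'D_v ('D_w G) q).
Proof.
move=> Uq; rewrite -derive_mulmx; last first.
  exact: smooth_on_derivable (smooth_on_derive _ sF) Uq.
have dG := smooth_on_derivable (v := v) sG Uq.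
have ddG := smooth_on_derivable (v := v) (smooth_on_derive w sG) Uq.
have dk := csmooth_derivable (v := v) sk Uq.
have ddk := csmooth_derivable (v := v) (csmooth_derive w sk) Uq.
have d1 := smooth_on_derivable (v := v)
  (smooth_on_scale oU (csmooth_derive w sk) sG) Uq.
have d2 := smooth_on_derivable (v := v)
  (smooth_on_scale oU sk (smooth_on_derive w sG)) Uq.
rewrite -(derive_scale ddk dG) -(derive_scale dk ddG) -(deriveD d1 d2).
by apply: derive_eq_on oU _ Uq => z Uz; exact: (derive_pair w Uz).
Qed.

Lemma sform_derive_pair q v w : U q ->
  sform 2 ('D_v F q) ('D_w F q) = k q ^+ 2 * sform 2 ('D_v G q) ('D_w G q).
Proof.
move=> Uq; rewrite -(oT ('D_v F q)) (derive_pair v Uq) (derive_pair w Uq).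
apply: sform_null_add; first exact: lift_null.
- exact: (sform_derive_lift oU sg cg v Uq).
- exact: (sform_derive_lift oU sg cg w Uq).
Qed.

Lemma sform_derive2_pair q v w W : U q ->
  sform 2 (G q) W = 0 -> sform 2 ('D_v G q) W = 0 -> sform 2 ('D_w G q) W = 0 ->
  sform 2 ('D_v ('D_w F) q *m T) W = k q * sform 2 ('D_v ('D_w G) q) W.
Proof.
move=> Uq G0 Gv Gw; rewrite (derive2_pair v w Uq).
exact: sform_combination.
Qed.

End conformal_pair.

(** * Transport of normals by a conformal transformation *)

Section transport.
Variables (R : realType) (n : nat) (c : curvature) (M : Type).
Variables (x y : M -> 'rV[R]_(amb_dim c n)) (k : M -> R) (T : 'M[R]_n.+3).

(* The image of the lifted normal under T, made tangent to the affine slice by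
   adding a multiple of [lift (y p)]; the sign turns the factor [(k p)^-1] of
   the second form into [`|k p|^-1]. *)
Definition transport_normal (p : M) (e : 'rV[R]_(amb_dim c n)) :
    'rV[R]_(amb_dim c n) :=
  let W := normal_lift (x p) e *m T in
  Num.sg (k p) *: ((W - (W *m lift_fun R n c) 0 0 *: lift (y p))
                     *m lift_proj R n c).

Hypotheses (oT : orthogonal_group 2 T) (k_neq0 : forall p, k p != 0).
Hypothesis cy : forall p, space_form c (y p).
Hypothesis xy : forall p, lift (x p) *m T = k p *: lift (y p).

Variable a : chart R n M.
Let U := chart_img a.
Hypothesis oU : open U.
Hypothesis sx : smooth_on U (x \o chart_inv a).
Hypothesis sy : smooth_on U (y \o chart_inv a).
Hypothesis sk : csmooth U (k \o chart_inv a).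

Variable p : M.
Hypotheses (Up : U (chart_map a p)) (ap : chart_inv a (chart_map a p) = p).

Let q := chart_map a p.
Let F z := lift (x (chart_inv a z)).
Let G z := lift (y (chart_inv a z)).
Let kq : (k \o chart_inv a) q = k p. Proof. by rewrite /= ap. Qed.
Let yq : y p = (y \o chart_inv a) q. Proof. by rewrite /= ap. Qed.

Lemma first_form_transport :
  first_form x a p = k p ^+ 2 *: first_form y a p.
Proof.
apply/matrixP => i j; rewrite !mxE /partial1.
rewrite !(amb_form_derive oU)// -kq.
exact: (sform_derive_pair oU sx sy (fun z => cy _) oT sk (fun z => xy _)).
Qed.

Section normal.
Variable e : 'rV[R]_(amb_dim c n).
Hypothesis en : unit_normal_at x a p e.

Let N := normal_lift (x p) e.
Let W := N *m T.
Let om := (W *m lift_fun R n c) 0 0.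
Let N' := Num.sg (k p) *: (W - om *: lift (y p)).

Let transportE : transport_normal p e = N' *m lift_proj R n c.
Proof. by rewrite /N' -scalemxAl. Qed.

Let N0 : N *m lift_fun R n c = 0. Proof. exact: normal_lift_fun. Qed.

Let Nproj : N *m lift_proj R n c = e. Proof. exact: normal_lift_proj. Qed.

Let N'0 : N' *m lift_fun R n c = 0.
Proof.
rewrite /N' -scalemxAl mulmxBl -scalemxAl lift_fun_lift scalemx1.
by rewrite [W *m _]mx11_scalar /om subrr scaler0.
Qed.

Let N'E Z : sform 2 Z N' =
  Num.sg (k p) * (sform 2 Z W - om * sform 2 Z (lift (y p))).
Proof. by rewrite /N' sformZr sformBr sformZr. Qed.

Let Nx : sform 2 N (lift (x p)) = 0.
Proof. by apply: normal_lift_orth; case: en. Qed.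

Let Wy : sform 2 (lift (y p)) W = 0.
Proof.
have : sform 2 (lift (x p) *m T) W = 0 by rewrite oT sformC.
by rewrite xy sformZl => /eqP; rewrite mulf_eq0 (negPf (k_neq0 _)) => /eqP.
Qed.

Let dGy i : sform 2 ('D_(delta_mx 0 i) G q) (lift (y p)) = 0.
Proof.
by rewrite yq; exact: (sform_derive_lift oU sy (fun z => cy _) _ Up).
Qed.

(** [N] is orthogonal to the derivatives of F. Under [T] this becomes orthogonality of [W] to Dk G +
    k DG, where [Wy] removes the first term and k is nonzero. *)
Let WdG i : sform 2 ('D_(delta_mx 0 i) G q) W = 0.
Proof.
have : sform 2 ('D_(delta_mx 0 i) F q *m T) W = 0.
  rewrite oT -(amb_form_derive_proj oU sx _ Up N0) Nproj.
  by case: en => _ + _; apply.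
have -> : 'D_(delta_mx 0 i) F q *m T =
    'D_(delta_mx 0 i) (k \o chart_inv a) q *: lift (y p) +
    k p *: 'D_(delta_mx 0 i) G q.
  rewrite yq -kq; exact: (derive_pair oU sx sy sk (fun z => xy _) _ Up).
rewrite (sformDl _ _ _ W) (sformZl _ _ _ W) Wy mulr0 add0r (sformZl _ _ _ W).
by move=> /eqP; rewrite mulf_eq0 (negPf (k_neq0 _)) => /eqP.
Qed.

Lemma transport_unit_normal : unit_normal_at y a p (transport_normal p e).
Proof.
have N'y : sform 2 N' (lift (y p)) = 0.
  by rewrite sformC N'E Wy (lift_null (cy p)) mulr0 subr0 mulr0.
rewrite transportE; split.
- exact: tangent_proj.
- move=> i; rewrite /partial1 (amb_form_derive_proj oU sy _ Up N'0).
  by rewrite N'E WdG dGy mulr0 subr0 mulr0.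
- rewrite (amb_form_proj N'0 N'0) N'E N'y [sform 2 N' W]sformC N'E.
  rewrite [sform 2 W (lift _)]sformC Wy oT -(amb_form_proj N0 N0) Nproj.
  case: en => _ _ ->; rewrite !mulr0 !subr0 mulrA -expr2 sqr_sg k_neq0.
  by rewrite mul1r.
Qed.

Lemma second_form_transport : exists al,
  second_form y a p (transport_normal p e) =
  `|k p|^-1 *: second_form x a p e + al *: first_form y a p.
Proof.
(* The scalar identity behind each entry: A and B pair the second derivative of G with [W] and with
   G, C pairs that of F with [N], and D is the entry of the metric of [y]. The sign of k is
   k/|k|. *)
have alg X Y Z A B C D : X = Num.sg (k p) * (A - om * B) -> Y = C -> Z = D ->
    B = - D -> C = k p * A ->
    - X = `|k p|^-1 * - Y + - (Num.sg (k p) * om) * Z.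
  have -> : Num.sg (k p) = `|k p|^-1 * k p.
    by rewrite {3}[k p]numEsg mulrCA mulVf ?mulr1 // normr_eq0.
  by move=> -> -> -> -> ->; ring.
exists (- (Num.sg (k p) * om)); apply/matrixP => i j.
have yN' : amb_form (partial2 a y p i j) (transport_normal p e) =
    sform 2 ('D_(delta_mx 0 i) ('D_(delta_mx 0 j) G) q) N'.
  by rewrite transportE; exact: (amb_form_derive2_proj oU sy _ _ Up N'0).
have xN : amb_form (partial2 a x p i j) e =
    sform 2 ('D_(delta_mx 0 i) ('D_(delta_mx 0 j) F) q) N.
  by rewrite -[in LHS]Nproj; exact: (amb_form_derive2_proj oU sx _ _ Up N0).
have yy : amb_form (partial1 a y p i) (partial1 a y p j) =
    sform 2 ('D_(delta_mx 0 i) G q) ('D_(delta_mx 0 j) G q).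
  exact: (amb_form_derive oU sy _ _ Up).
rewrite !mxE; apply: (alg _ _ _ _ _ _ _ (etrans yN' (N'E _)) xN yy).
  by rewrite yq; exact: (sform_derive2_lift oU sy (fun z => cy _) _ _ Up).
have yW : sform 2 (lift ((y \o chart_inv a) q)) W = 0 by rewrite -yq.
have E := sform_derive2_pair oU sx sy sk (fun z => xy _) Up yW (WdG i) (WdG j).
by rewrite kq in E; exact: (etrans (esym (oT _ _)) E).
Qed.

End normal.
End transport.

(** * Orthogonal complements and the normal line *)

(** The Gram matrix [J] turns orthogonality to the m independent rows of [B] into membership in the
    kernel of a matrix of rank m, which is a line in dimension m+1. *)
Lemma sform_orth_line (R : realType) (s m : nat) (B : 'M[R]_(m, m.+1))
    (w w' : 'rV[R]_m.+1) :
  row_free B -> w != 0 ->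
  (forall i, sform s (row i B) w = 0) -> (forall i, sform s (row i B) w' = 0) ->
  exists t, w' = t *: w.
Proof.
move=> fB w0 Hw Hw'.
pose J : 'M[R]_m.+1 := diag_mx (\row_i (-1) ^+ (i < s)%N).
have sJ X Y : sform s X Y = (Y *m (X *m J)^T) 0 0.
  rewrite /sform mxE; apply: eq_bigr => i _.
  by rewrite mul_mx_diag !mxE; ring.
have JJ : J *m J = 1%:M.
  apply/matrixP => i j; rewrite mul_mx_diag !mxE.
  case: eqP => [->|_]; last by rewrite !mulr0n mul0r.
  by rewrite !mulr1n -expr2 sqrr_sign.
have Ju : J \in unitmx by have [] := mulmx1_unit JJ.
pose K := (B *m J)^T.
have kerK X : (forall i, sform s (row i B) X = 0) -> (X <= kermx K)%MS.
  move=> HX; apply/sub_kermxP/rowP => i; have := HX i.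
  rewrite sJ -row_mul => H; rewrite [RHS]mxE -H !mxE.
  by apply: eq_bigr => j _; rewrite !mxE.
have rK : \rank (kermx K) = 1%N.
  rewrite mxrank_ker mxrank_tr mxrankMfree ?row_free_unit//.
  by move: fB; rewrite /row_free => /eqP ->; rewrite subSnn.
have : (kermx K <= w)%MS.
  by have [_] := mxrank_leqif_sup (kerK _ Hw); rewrite rK rank_rV w0 => <-.
by move=> /(submx_trans (kerK _ Hw')) /sub_rVP.
Qed.

(** Pairing a vanishing combination with the non-null [u] kills the coefficient of [u]. It serves to
    adjoin the position vector to the tangent vectors when c is not 0. *)
Lemma row_free_col_orth (R : realType) (s m n : nat) (u : 'rV[R]_m) (V : 'M[R]_(n, m)) :
  row_free V -> sform s u u != 0 -> (forall i, sform s u (row i V) = 0) ->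
  row_free (col_mx u V).
Proof.
move=> fV uu uV; rewrite -kermx_eq0; apply/eqP/row_matrixP => i; rewrite row0.
set v := row i _; have : v *m col_mx u V = 0 by rewrite -row_mul mulmx_ker row0.
rewrite -[v]hsubmxK mul_row_col [lsubmx v]mx11_scalar mul_scalar_mx => H.
have uVb b : sform s (b *m V) u = 0.
  rewrite mulmx_sum_row; elim/big_rec: _ => [|j z _ IH]; first exact: sform0l.
  by rewrite sformDl sformZl sformC uV mulr0 add0r.
have := congr1 (fun z => sform s z u) H.
rewrite sformDl uVb sform0l addr0 sformZl => /eqP.
rewrite mulf_eq0 (negPf uu) orbF => /eqP l0.
move: H; rewrite l0 scale0r add0r => H.
by rewrite (row_free_injr fV (etrans H (esym (mul0mx _ V)))) raddf0 row_mx0.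
Qed.

(** * Metric and shape operator *)

Section forms.
Variables (R : realType) (n : nat) (c : curvature) (M : Type).
Variables (x : M -> 'rV[R]_(amb_dim c n)) (a : chart R n M) (p : M).
Implicit Type e : 'rV[R]_(amb_dim c n).

Definition positive_form (g : 'M[R]_n) : Prop :=
  forall v : 'rV[R]_n, v != 0 -> 0 < (v *m g *m v^T) 0 0.

Lemma positive_form_unitmx g : positive_form g -> g \in unitmx.
Proof.
move=> gP; rewrite -row_free_unit -kermx_eq0; apply/eqP/row_matrixP => i.
rewrite row0; apply/eqP/negPn/negP => /gP.
by rewrite -row_mul mulmx_ker row0 mul0mx mxE ltxx.
Qed.

Lemma positive_formZ g (t : R) : 0 < t -> positive_form g -> positive_form (t *: g).
Proof.
move=> t0 gP v v0; rewrite -scalemxAr -scalemxAl mxE.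
by rewrite mulr_gt0// gP.
Qed.

Lemma trmx_first_form : (first_form x a p)^T = first_form x a p.
Proof.
apply/matrixP => i j; rewrite mxE [LHS]mxE [RHS]mxE.
exact: (sformC _ (partial1 a x p j) (partial1 a x p i)).
Qed.

(** A linear relation between the partial derivatives lies in the kernel of the metric. This yields
    the immersion property of [y] from its metric. *)
Lemma positive_first_form_row_free :
  positive_form (first_form x a p) -> row_free (\matrix_i partial1 a x p i).
Proof.
move=> gP; rewrite -kermx_eq0; apply/eqP/row_matrixP => i.
rewrite row0; apply/eqP/negPn/negP; set v := row i _ => v0.
have vX : v *m (\matrix_i partial1 a x p i) = 0.
  by rewrite -row_mul mulmx_ker row0.
have vg : v *m first_form x a p = 0.
  apply/rowP => j; rewrite !mxE.
  transitivity (amb_form (v *m (\matrix_i partial1 a x p i)) (partial1 a x p j)).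
    rewrite mulmx_sum_row; elim/big_rec2: _ => [|l z1 z2 _ ->].
      by rewrite /amb_form sform0l.
    by rewrite [first_form _ _ _ _ _]mxE /amb_form sformDl sformZl rowK.
  by rewrite vX /amb_form sform0l.
by have := gP _ v0; rewrite vg mul0mx mxE ltxx.
Qed.

Lemma second_formN e : second_form x a p (- e) = - second_form x a p e.
Proof. by apply/matrixP => i j; rewrite !mxE /amb_form sformC sformNl sformC. Qed.

Lemma shape_operatorN e : shape_operator x a p (- e) = - shape_operator x a p e.
Proof. by rewrite /shape_operator second_formN mulNmx. Qed.

(** The normals at a point lie on one line, and <e, e> = -1 forces a factor of square 1. *)
Lemma unit_normal_unique e e' :
  (forall i, tangent_space_form (x p) (partial1 a x p i)) ->
  space_form c (x p) -> positive_form (first_form x a p) ->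
  unit_normal_at x a p e -> unit_normal_at x a p e' -> e' = e \/ e' = - e.
Proof.
move=> tx cx /positive_first_form_row_free fX [te xe ee] [te' xe' ee'].
have e0 : e != 0.
  apply/eqP => e0; move: ee; rewrite e0 /amb_form sform0l => /eqP.
  by rewrite eq_sym oppr_eq0 oner_eq0.
suff [t et] : exists t, e' = t *: e.
  move: ee'; rewrite et /amb_form sformZl sformZr -/(amb_form e e) ee => /eqP.
  rewrite mulrA mulrN1 eqr_opp -expr2 sqrf_eq1 => /orP[] /eqP ->.
    by left; rewrite scale1r.
  by right; rewrite scaleN1r.
clear ee ee'; move: tx cx fX te xe te' xe' e0; move: e e'.
rewrite /space_form /tangent_space_form /amb_form.
move: (x p) (partial1 a x p); case: (c) => u X e e' tx cx fX te xe te' xe' e0.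
- apply: (sform_orth_line (s := 1) fX e0) => i; rewrite rowK; [exact: xe|exact: xe'].
(* In the curved cases the ambient space has dimension n+2; the position vector, orthogonal to
   tangent and normal vectors, supplies the missing row. *)
- apply: (@sform_orth_line _ 1 _ (col_mx u (\matrix_i X i)) e e' _ e0).
  + apply: (row_free_col_orth (s := 1)) => // [|i].
      by rewrite cx oner_eq0.
    by rewrite rowK tx.
  + move=> i; case: (split_ordP i) => j ->; rewrite ?rowKu ?rowKd ?rowK//.
    by rewrite row_id.
  + move=> i; case: (split_ordP i) => j ->; rewrite ?rowKu ?rowKd ?rowK//.
    by rewrite row_id.
- apply: (@sform_orth_line _ 2 _ (col_mx u (\matrix_i X i)) e e' _ e0).
  + apply: (row_free_col_orth (s := 2)) => // [|i].
      by rewrite cx oppr_eq0 oner_eq0.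
    by rewrite rowK tx.
  + move=> i; case: (split_ordP i) => j ->; rewrite ?rowKu ?rowKd ?rowK//.
    by rewrite row_id.
  + move=> i; case: (split_ordP i) => j ->; rewrite ?rowKu ?rowKd ?rowK//.
    by rewrite row_id.
Qed.

End forms.

(** * Conformal change of the metric and of the second form *)

Section conformal_change.
Variables (R : realType) (n : nat) (g g' b b' : 'M[R]_n) (k al : R).
Hypotheses (k_gt0 : 0 < k) (gE : g = k ^+ 2 *: g').
Hypothesis bE : b' = k^-1 *: b + al *: g'.

Let k0 : k != 0. Proof. exact: lt0r_neq0. Qed.

Lemma conformal_shape : g \in unitmx ->
  b' *m invmx g' = k *: (b *m invmx g) + al%:M.
Proof.
move=> gu; have g'E : g' = k ^- 2 *: g.
  by rewrite gE scalerA mulVf ?scale1r// expf_neq0.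
have g'u : g' \in unitmx by rewrite g'E unitmxZ// unitfE invr_eq0 expf_neq0.
have ig : invmx g = k ^- 2 *: invmx g' by rewrite gE invmxZ// -gE.
rewrite bE mulmxDl -!scalemxAl mulmxV// scalemx1; congr (_ + _).
rewrite ig -scalemxAr scalerA; congr (_ *: _).
by rewrite expr2 invfM mulrA mulfV// mul1r.
Qed.

Lemma conformal_frame (E E' : 'M[R]_n) : g^T = g ->
  E *m g *m E^T = 1%:M -> E' *m g' *m E'^T = 1%:M ->
  exists2 Q : 'M[R]_n, Q *m Q^T = 1%:M &
    E' *m b' *m E'^T = k *: (Q *m (E *m b *m E^T) *m Q^T) + al%:M.
Proof.
move=> gT gE1 gE2.
have EEg : E^T *m (E *m g) = 1%:M by exact: mulmx1C.
have gEE : g *m E^T *m E = 1%:M by apply: mulmx1C; rewrite mulmxA.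
have Qg (A : 'M[R]_n) : E' *m g *m E^T *m E *m A = E' *m A.
  by rewrite -!(mulmxA E') gEE mul1mx.
(* [k^-1 *: E'] is orthonormal for [g], and [Q] is its coordinate matrix in the frame [E]: Q E =
   k^-1 E'. *)
exists (k^-1 *: (E' *m g *m E^T)).
  rewrite linearZ/= -scalemxAl -scalemxAr scalerA !trmx_mul trmxK gT.
  rewrite [X in _ *: X](_ : _ = E' *m g *m E'^T).
    by rewrite gE -scalemxAr -scalemxAl scalerA gE2 -invfM -expr2 mulVf ?scale1r// expf_neq0.
  by rewrite !mulmxA Qg// mulmxA.
rewrite linearZ/= -!scalemxAl -!scalemxAr !scalerA !trmx_mul trmxK gT.
rewrite bE mulmxDr mulmxDl -!scalemxAr -!scalemxAl gE2 scalemx1; congr (_ + _).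
rewrite [X in _ = X *: _](_ : _ = k^-1); last by field.
congr (_ *: _).
have -> : E' *m g *m E^T *m (E *m b *m E^T) *m (E *m (g *m E'^T)) =
  E' *m (g *m E^T *m E) *m b *m (E^T *m (E *m g)) *m E'^T by rewrite !mulmxA.
by rewrite gEE EEg !mulmx1.
Qed.

End conformal_change.

(** Translates non-umbilicity into the statement that the matrix of II in an orthonormal frame is
    not scalar. *)
Lemma frame_scalar (R : realType) (n : nat) (g b E : 'M[R]_n) (t : R) :
  E *m g *m E^T = 1%:M -> E *m b *m E^T = t%:M -> b = t *: g.
Proof.
move=> gE bE.
have EEg : E^T *m (E *m g) = 1%:M by exact: mulmx1C.
have gEE : g *m E^T *m E = 1%:M by apply: mulmx1C; rewrite mulmxA.
have : g *m E^T *m (E *m b *m E^T) *m (E *m g) = b.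
  have -> : g *m E^T *m (E *m b *m E^T) *m (E *m g) =
    (g *m E^T *m E) *m b *m (E^T *m (E *m g)) by rewrite !mulmxA.
  by rewrite gEE EEg mul1mx mulmx1.
by rewrite bE mul_mx_scalar -scalemxAl -mulmxA EEg mulmx1.
Qed.
(** * Conformally related hypersurfaces *)

Section related_at.
Variables (R : realType) (n : nat) (c : curvature) (M : Type).
Variables (x y : M -> 'rV[R]_(amb_dim c n)) (k : M -> R) (T : 'M[R]_n.+3).
Hypotheses (oT : orthogonal_group 2 T) (k_neq0 : forall p, k p != 0).
Hypothesis cy : forall p, space_form c (y p).
Hypothesis xy : forall p, lift (x p) *m T = k p *: lift (y p).

Variable a : chart R n M.
Let U := chart_img a.
Hypothesis oU : open U.
Hypothesis sx : smooth_on U (x \o chart_inv a).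
Hypothesis sy : smooth_on U (y \o chart_inv a).
Hypothesis sk : csmooth U (k \o chart_inv a).

Variable p : M.
Hypotheses (Up : U (chart_map a p)) (ap : chart_inv a (chart_map a p) = p).

Local Notation tr e := (transport_normal x y k T p e).

Let kp : 0 < `|k p|. Proof. by rewrite normr_gt0. Qed.

Let gE : first_form x a p = `|k p| ^+ 2 *: first_form y a p.
Proof.
rewrite real_normK ?num_real//.
exact: (first_form_transport oT cy xy oU sx sy sk Up ap).
Qed.

Lemma tangent_partial1 i : tangent_space_form (y p) (partial1 a y p i).
Proof.
rewrite /partial1 -(derive_lift_proj oU sy)//; apply: tangent_proj.
  exact: derive_lift_fun oU sy _ _ Up.
have := sform_derive_lift oU sy (fun z => cy _) (delta_mx 0 i) Up.
by rewrite /= ap.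
Qed.

Lemma positive_form_related :
  positive_form (first_form x a p) -> positive_form (first_form y a p).
Proof.
move=> gP; have -> : first_form y a p = `|k p| ^- 2 *: first_form x a p.
  by rewrite gE scalerA mulVf ?scale1r// expf_neq0// lt0r_neq0.
by apply: positive_formZ => //; rewrite invr_gt0 exprn_gt0.
Qed.

(** Applied later with the roles of [x] and [y] exchanged, to bring an umbilical point of [y] back
    to [x]. *)
Lemma umbilical_related : umbilical_at x a p -> umbilical_at y a p.
Proof.
move=> [e [en [l le]]]; exists (tr e); split.
  exact: (transport_unit_normal oT k_neq0 cy xy oU sx sy sk Up ap en).
have [al ->] := second_form_transport oT k_neq0 cy xy oU sx sy sk Up ap en.
rewrite le gE !scalerA -scalerDl; eexists; reflexivity.
Qed.

Hypothesis gP : positive_form (first_form x a p).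
Variable e : 'rV[R]_(amb_dim c n).
Hypothesis en : unit_normal_at x a p e.

Lemma shape_operator_related : exists al,
  shape_operator y a p (tr e) = `|k p| *: shape_operator x a p e + al%:M.
Proof.
have [al bE] := second_form_transport oT k_neq0 cy xy oU sx sy sk Up ap en.
by exists al; apply: (conformal_shape kp gE bE); exact: positive_form_unitmx.
Qed.

(** One [al] serves both relations: the eigenvalues come from the shape operator, whereas [tau] and
    H are computed from the matrix of II in a frame. *)
Lemma hcoef_related (E E' : 'M[R]_n) :
  orthonormal_frame x a p E -> orthonormal_frame y a p E' ->
  exists al Q, [/\ Q *m Q^T = 1%:M,
    hcoef y a p (tr e) E' = `|k p| *: (Q *m hcoef x a p e E *m Q^T) + al%:M &
    shape_operator y a p (tr e) = `|k p| *: shape_operator x a p e + al%:M].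
Proof.
move=> oE oE'.
have [al bE] := second_form_transport oT k_neq0 cy xy oU sx sy sk Up ap en.
have [Q QQ hE] := conformal_frame kp gE bE (trmx_first_form x a p) oE oE'.
exists al, Q; split => //.
by apply: (conformal_shape kp gE bE); exact: positive_form_unitmx.
Qed.

End related_at.

(** * Eigenvectors and Möbius curvatures under an affine change *)

Section affine_eigen.
Variables (R : realType) (n : nat) (S S' : 'M[R]_n) (t al : R).
Hypotheses (t0 : t != 0) (SE : S' = t *: S + al%:M).

Lemma affine_eigenvector (v : 'rV[R]_n) (l : R) :
  v *m S = l *: v -> v *m S' = (t * l + al) *: v.
Proof.
by move=> vS; rewrite SE mulmxDr -scalemxAr vS scalerA mul_mx_scalar -scalerDl.
Qed.

Lemma affine_eigenvector_inv (v : 'rV[R]_n) (l' : R) :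
  v *m S' = l' *: v -> v *m S = ((l' - al) / t) *: v.
Proof.
rewrite SE mulmxDr -scalemxAr mul_mx_scalar => H.
apply: (@scalerI _ _ t) => //; rewrite scalerA mulrC divfK// scalerBl -H.
by rewrite addrK.
Qed.

Lemma affine_eigenvalue (v : 'rV[R]_n) (l l' : R) : v != 0 ->
  v *m S = l *: v -> v *m S' = l' *: v -> l' = t * l + al.
Proof.
move=> v0 /affine_eigenvector -> /eqP.
by rewrite -subr_eq0 -scalerBl scaler_eq0 (negPf v0) orbF subr_eq0 => /eqP.
Qed.

End affine_eigen.

(** The shift cancels in the differences and the factor in their quotient. The factor may be
    negative, as happens when a normal is reversed. *)
Lemma moebius_curvature_affine (R : realType) (t al li lj ls : R) :
  t != 0 -> li != ls ->
  t * li + al != t * ls + al /\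
  moebius_curvature li lj ls =
  moebius_curvature (t * li + al) (t * lj + al) (t * ls + al).
Proof.
move=> t0 lis; have E l l' : t * l + al - (t * l' + al) = t * (l - l') by ring.
rewrite -subr_eq0 E mulf_neq0 ?subr_eq0//; split => //.
by rewrite /moebius_curvature !E -mulf_div divff// mul1r.
Qed.

(** * The conformal transformation in terms of lifts *)

Section conformal_map.
Variables (R : realType) (n : nat) (c : curvature) (T : 'M[R]_n.+3).
Hypothesis oT : orthogonal_group 2 T.
Implicit Type u : 'rV[R]_(amb_dim c n).

(** Two lifts on the same line are equal because the linear form is 1 on both. *)
Lemma sigma_inj : {in space_form c &, injective (@sigma R n c)}.
Proof.
move=> u u' _ _; rewrite !sigmaE => E.
have : proj_point (lift u') (lift u) by rewrite -E; exists 1; rewrite ?scale1r.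
move=> [t _ tE]; rewrite -[LHS]lift_proj_lift -[RHS]lift_proj_lift.
have := congr1 (mulmx^~ (lift_fun R n c)) tE.
rewrite /= -scalemxAl !lift_fun_lift => /matrixP/(_ 0 0).
by rewrite !mxE mulr1 => t1; rewrite -tE t1 scale1r.
Qed.

(** The factor k of the overview: applying the linear form to F T = k G isolates k, since the form
    is 1 on G. This formula also shows that k is smooth. *)
Definition conformal_scale u : R := (lift u *m T *m lift_fun R n c) 0 0.

(** On [conformal_dom] the pseudo-inverse of [sigma] is a true inverse, so its default value never
    occurs. The factor is nonzero because [T] is invertible and lifts are nonzero. *)
Lemma conformal_mapP u : conformal_dom T u ->
  [/\ space_form c (conformal_map T u), conformal_scale u != 0 &
      lift u *m T = conformal_scale u *: lift (conformal_map T u)].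
Proof.
move=> [_ dom]; set w := conformal_map T u.
have [cw ws] : space_form c w /\ sigma c w = proj_act T (sigma c u).
  split.
    rewrite -[space_form c](injpinv_image (fun=> 0) sigma_inj).
    by exists (proj_act T (sigma c u)).
  exact: (pinvK (fun=> 0) (mem_set dom)).
have [t tE] : exists t, lift u *m T = t *: lift w.
  have : proj_act T (sigma c u) (lift u *m T).
    by exists (lift u) => //; rewrite sigmaE; exists 1; rewrite ?scale1r.
  by rewrite -ws sigmaE => -[t _ <-]; exists t.
have scE : conformal_scale u = t.
  by rewrite /conformal_scale tE -scalemxAl lift_fun_lift !mxE mulr1.
split; rewrite ?scE//; apply/eqP => t0.
have : lift u = 0.
  by rewrite -[lift u](mulmxK (orthogonal_unitmx oT)) tE t0 scale0r mul0mx.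
move=> /(congr1 (mulmx^~ (lift_fun R n c)))/=.
by rewrite lift_fun_lift mul0mx => /matrixP/(_ 0 0)/eqP; rewrite !mxE oner_eq0.
Qed.

End conformal_map.

(** The b_i are compared both as families of roots, in arbitrary orthonormal frames, and eigenvector
    by eigenvector. The Möbius part admits any unit normals of the two hypersurfaces at p, since a
    sign cancels in the quotient. *)
Theorem proposition2p1 (R : realType) (n : nat) (c : curvature)
    (M : smooth_manifold R n) (x : M -> 'rV[R]_(amb_dim c n))
    (T : 'M[R]_n.+3) :
  spacelike_hypersurface x ->
  no_umbilical_point x ->
  orthogonal_group 2 T ->
  (forall p, conformal_dom T (x p)) ->
  let y : M -> 'rV[R]_(amb_dim c n) := conformal_map T \o x in
  [/\ spacelike_hypersurface y,
      no_umbilical_point y,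
      (forall e : M -> 'rV[R]_(amb_dim c n), unit_normal_field x e ->
       exists e' : M -> 'rV[R]_(amb_dim c n), unit_normal_field y e' /\
         forall (a : chart R n M) (p : M), atlas a -> chart_dom a p ->
           (forall v : 'rV[R]_n,
              (exists l, principal_vector x a p (e p) l v) <->
              (exists l, principal_vector y a p (e' p) l v)) /\
           forall E E' : 'M[R]_n,
             orthonormal_frame x a p E -> orthonormal_frame y a p E' ->
             (forall b : 'I_n -> R,
                conformal_curvatures (hcoef x a p (e p) E) b <->
                conformal_curvatures (hcoef y a p (e' p) E') b) /\
             (forall (v : 'rV[R]_n) (l l' : R),
                principal_vector x a p (e p) l v ->
                principal_vector y a p (e' p) l' v ->
                conformal_curvature (hcoef x a p (e p) E) l =
                conformal_curvature (hcoef y a p (e' p) E') l')) &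
      (forall (a : chart R n M) (p : M), atlas a -> chart_dom a p ->
       forall e e' : 'rV[R]_(amb_dim c n),
         unit_normal_at x a p e -> unit_normal_at y a p e' ->
       forall (v : 'I_n -> 'rV[R]_n) (l l' : 'I_n -> R),
         (forall i, principal_vector x a p e (l i) (v i)) ->
         (forall i, principal_vector y a p e' (l' i) (v i)) ->
       forall i j s : 'I_n, l i != l s ->
         l' i != l' s /\
         moebius_curvature (l i) (l j) (l s) =
         moebius_curvature (l' i) (l' j) (l' s))].
Proof.
move=> [cx sx fx gx] nux oT dom y.
pose k p := conformal_scale T (x p).
have cy p : space_form c (y p) by have [] := conformal_mapP oT (dom p).
have k0 p : k p != 0 by have [] := conformal_mapP oT (dom p).
have xy p : lift (x p) *m T = k p *: lift (y p).
  by have [] := conformal_mapP oT (dom p).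
have [Ach _ _] := mfd_atlas M.
have oU (a : chart R n M) : atlas a -> open (chart_img a) by move=> Aa; have [] := Ach a Aa.
have ap (a : chart R n M) p : atlas a -> chart_dom a p -> chart_inv a (chart_map a p) = p.
  by move=> Aa; have [_ _ + _ _] := Ach a Aa; apply.
have Up (a : chart R n M) p : chart_dom a p -> chart_img a (chart_map a p) by exists p.
have sk (a : chart R n M) : atlas a -> csmooth (chart_img a) (k \o chart_inv a).
  move=> Aa; have sL := smooth_lift (oU a Aa) (sx a Aa).
  have := smooth_on_mulmx (lift_fun R n c) (oU a Aa)
    (smooth_on_mulmx T (oU a Aa) sL).
  by move=> /(smooth_onP _ (oU a Aa))/(_ 0).
(* Expresses [y] through smooth maps and the nonvanishing k, which gives its smoothness. *)
have yE p : y p = (k p)^-1 *: (lift (x p) *m T *m lift_proj R n c).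
  by rewrite xy -scalemxAl lift_proj_lift scalerA mulVf// scale1r.
have sy : smooth_map y.
  move=> a Aa; have sL := smooth_lift (oU a Aa) (sx a Aa).
  apply: (smooth_on_eq (oU a Aa) _ (smooth_on_scale (oU a Aa)
    (csmoothV (oU a Aa) _ (sk a Aa))
    (smooth_on_mulmx (lift_proj R n c) (oU a Aa)
      (smooth_on_mulmx T (oU a Aa) sL)))) => [z _|z _] /=.
    by rewrite yE.
  exact: k0.
have gy (a : chart R n M) p : atlas a -> chart_dom a p -> positive_form (first_form y a p).
  move=> Aa ap_; exact: (positive_form_related oT k0 cy xy (oU a Aa) (sx a Aa)
    (sy a Aa) (sk a Aa) (Up a p ap_) (ap a p Aa ap_) (gx a p Aa ap_)).
(* The relation read backwards, with [invmx T] and 1/k, so that umbilical points of [y] can be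
   transported to [x]. *)
have xy' p : lift (y p) *m invmx T = (k p)^-1 *: lift (x p).
  rewrite -[lift (x p)](mulmxK (orthogonal_unitmx oT)) xy -scalemxAl scalerA.
  by rewrite mulVf// scale1r.
split.
- split => //.
  move=> a p Aa ap_; exact: positive_first_form_row_free (gy a p Aa ap_).
- move=> a p Aa ap_ uy; apply: (nux a p Aa ap_).
  apply: (umbilical_related (orthogonal_invmx oT) _ cx xy' (oU a Aa) (sy a Aa)
    (sx a Aa) _ (Up a p ap_) (ap a p Aa ap_) uy).
    by move=> q; rewrite invr_eq0.
  exact: (csmoothV (oU a Aa) (fun z _ => k0 _) (sk a Aa)).
- move=> e [se ne]; exists (fun p => transport_normal x y k T p (e p)); split.
    split=> [a Aa|a p Aa ap_]; last first.
      exact: (transport_unit_normal oT k0 cy xy (oU a Aa) (sx a Aa) (sy a Aa)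
        (sk a Aa) (Up a p ap_) (ap a p Aa ap_) (ne a p Aa ap_)).
    have oa := oU a Aa.
    have sW := smooth_on_mulmx T oa (smooth_normal_lift oa (sx a Aa) (se a Aa)).
    have /(smooth_onP _ oa)/(_ 0) som := smooth_on_mulmx (lift_fun R n c) oa sW.
    apply: (smooth_on_scale oa (csmooth_sg oa (fun z _ => k0 _) (sk a Aa))).
    apply: (smooth_on_mulmx _ oa (smooth_onB oa sW _)).
    exact: (smooth_on_scale oa som (smooth_lift oa (sy a Aa))).
  move=> a p Aa ap_; have en := ne a p Aa ap_; have gP := gx a p Aa ap_.
  have kp : 0 < `|k p| by rewrite normr_gt0.
  split=> [v|E E' oE oE'].
    have [al SE] := shape_operator_related oT k0 cy xy (oU a Aa) (sx a Aa)
      (sy a Aa) (sk a Aa) (Up a p ap_) (ap a p Aa ap_) gP en.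
    split=> -[l [v0 vl]].
      by exists (`|k p| * l + al); split => //; exact: affine_eigenvector SE _ _ vl.
    exists ((l - al) / `|k p|); split => //.
    exact: affine_eigenvector_inv (lt0r_neq0 kp) SE _ _ vl.
  have [al [Q [QQ hE SE]]] := hcoef_related oT k0 cy xy (oU a Aa) (sx a Aa)
      (sy a Aa) (sk a Aa) (Up a p ap_) (ap a p Aa ap_) gP en oE oE'.
  have hN : ~ (exists t, hcoef x a p (e p) E = t%:M).
    move=> [t ht]; apply: (nux a p Aa ap_); exists (e p); split => //.
    by exists t; exact: frame_scalar oE ht.
  split=> [b|v l l' [v0 vl] [_ vl']].
    exact: (conformal_curvatures_similarP b kp QQ hE hN).
  rewrite (affine_eigenvalue SE v0 vl vl').
  by rewrite (conformal_curvature_similar kp QQ hE hN).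
- move=> a p Aa ap_ e e' en en' v l l' vl vl' i j s lis.
  have gP := gx a p Aa ap_.
  have [al SE] := shape_operator_related oT k0 cy xy (oU a Aa) (sx a Aa)
    (sy a Aa) (sk a Aa) (Up a p ap_) (ap a p Aa ap_) gP en.
  have tn := transport_unit_normal oT k0 cy xy (oU a Aa) (sx a Aa) (sy a Aa)
    (sk a Aa) (Up a p ap_) (ap a p Aa ap_) en.
  have kp : `|k p| != 0 by rewrite normr_eq0.
  (* The given normal [e'] is the transported one or its opposite; in the second case both
     coefficients of the affine relation change sign. *)
  have [t [be [t0 SE']]] : exists t be, t != 0 /\
      shape_operator y a p e' = t *: shape_operator x a p e + be%:M.
    have ty := tangent_partial1 cy (oU a Aa) (sy a Aa) (Up a p ap_) (ap a p Aa ap_).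
    have [->|->] := unit_normal_unique ty (cy p) (gy a p Aa ap_) tn en'.
      by exists `|k p|, al.
    exists (- `|k p|), (- al); rewrite oppr_eq0; split => //.
    by rewrite shape_operatorN SE opprD scaleNr rmorphN.
  have ll i0 : l' i0 = t * l i0 + be.
    have [v0 vi] := vl i0; have [_ vi'] := vl' i0.
    exact: (affine_eigenvalue SE' v0 vi vi').
  by rewrite !ll; exact: moebius_curvature_affine.
Qed.
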